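(* Let $(M,g)$ be a smooth, connected, compact Riemannian manifold without boundary, of dimension $n\ge 2$, whose sectional curvature satisfies $-\frac{n}{n-1}\beta<\sec\le-\beta<0$ for some real number $\beta>0$, and let $p\ge 2$. Then every nonzero eigenvalue $\lambda_a^{(p)}$ of the Sampson Laplacian $\Delta_S:C^\infty(S_0^pM)\to C^\infty(S_0^pM)$ satisfies $\lambda_a^{(p)}\ge p(n+p-2)\,\beta$.
   Context: $S_0^pM$ is the bundle of symmetric covariant $p$-tensors on $M$ that are totally traceless (the $g$-trace over any pair of indices vanishes). The sign convention for the curvature tensor $R_{ijkl}$ is such that $\sec(X,Y)=R(X,Y,X,Y)$ for orthonormal $X,Y$, and the Ricci tensor is $R_{kl}=R^i{}_{kil}$. The Sampson Laplacian is $\Delta_S=\bar\Delta-\mathfrak{R}_p$, where $\bar\Delta=\nabla^*\nabla$ is the rough Laplacian ($\nabla$ the Levi-Civita connection, $\nabla^*$ its formal $L^2$-adjoint) and $\mathfrak{R}_p$ is the Weitzenböck curvature operator $$\mathfrak{R}_p(\varphi)_{i_1\ldots i_p}=\sum_{a=1}^{p}g^{jk}R_{i_aj}\,\varphi_{i_1\ldots i_{a-1}k\,i_{a+1}\ldots i_p}-\sum_{a\ne b}g^{jk}g^{lm}R_{i_aj\,i_bl}\,\varphi_{i_1\ldots k\ldots m\ldots i_p},$$ where in the second sum $k$ stands in position $a$ and $m$ in position $b$. (Equivalently $\Delta_S=\delta\delta^*-\delta^*\delta$ on symmetric tensors, where $\delta$ is the divergence and $\delta^*=(p+1)\,\mathrm{Sym}\circ\nabla$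 on symmetric $p$-tensors.) An eigenvalue is a real $\lambda$ with $\Delta_S\varphi=\lambda\varphi$ for some nonzero $\varphi\in C^\infty(S_0^pM)$; the discrete spectrum is denoted $\{\lambda_a^{(p)}\}_{a\ge 1}$. Inequalities on $\sec$ are meant for all tangent $2$-planes at all points. *)

(* Defs.v *)
From mathcomp Require Import all_boot all_order all_algebra.
From mathcomp Require Import perm.
From mathcomp Require Import all_classical all_reals all_analysis.

Set Implicit Arguments.
Unset Strict Implicit.
Unset Printing Implicit Defensive.

Import Order.TTheory GRing.Theory Num.Theory.
Import numFieldNormedType.Exports.

Local Open Scope classical_set_scope.
Local Open Scope ring_scope.

(* Differential geometry is set up in the classical way: points of R^n are row
   vectors, and a tensor field is the family of its component functions in the
   charts of an atlas. *)

Section Euclidean.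
Variables (R : realType) (n : nat).
Implicit Types (D : set 'rV[R]_n) (f : 'rV[R]_n -> R) (v : 'rV[R]_n).

Definition pderiv (j : 'I_n) f v : R := 'D_(delta_mx 0 j) f v.

Definition continuous_on D f := forall v, D v -> {for v, continuous f}.

(* f is C^k on D; only used for open D *)
Fixpoint Ck (k : nat) D f : Prop :=
  if k is k'.+1 then
    continuous_on D f /\
    forall j : 'I_n, (forall v, D v -> derivable f v (delta_mx 0 j)) /\
                     Ck k' D (pderiv j f)
  else continuous_on D f.

Definition smooth_on D f := forall k, Ck k D f.

End Euclidean.

(* The integral over R^n of a nonnegative Borel function, as the iterated
   one-dimensional Lebesgue integral (Tonelli). *)
Fixpoint iterated_integral (R : realType) (n : nat) :
    ('rV[R]_n -> \bar R) -> \bar R :=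
  match n with
  | 0 => fun f => f 0
  | m.+1 => fun f =>
      (\int[@lebesgue_measure R]_(t in [set: R])
         iterated_integral (fun w : 'rV[R]_m =>
           f (row_mx (const_mx t : 'rV[R]_1) w)))%E
  end.

Record chart (R : realType) (n : nat) (M : topologicalType) := Chart {
  chart_dom : set M;
  chart_coord : M -> 'rV[R]_n;
  chart_inv : 'rV[R]_n -> M;
  chart_dom_open : open chart_dom;
  chart_image_open : open (chart_coord @` chart_dom);
  chart_coordK : forall q, chart_dom q -> chart_inv (chart_coord q) = q;
  chart_coord_continuous : forall q, chart_dom q -> {for q, continuous chart_coord};
  chart_inv_continuous :
    forall v, (chart_coord @` chart_dom) v -> {for v, continuous chart_inv} }.

(* All charts are onto open subsets of R^n, so there is no boundary.  The
   atlas need not be maximal.  The base point carried by a ptopologicalType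
   only records that the manifold is nonempty. *)
Record manifold (R : realType) (n : nat) := Manifold {
  carrier :> ptopologicalType;
  manifold_hausdorff : hausdorff_space carrier;
  manifold_second_countable : @second_countable carrier;
  chart_index : Type;
  atlas : chart_index -> chart R n carrier;
  atlas_cover : forall q, exists a, chart_dom (atlas a) q;
  atlas_smooth : forall a b (k : 'I_n),
    smooth_on [set v | (chart_coord (atlas a) @` chart_dom (atlas a)) v /\
                       chart_dom (atlas b) (chart_inv (atlas a) v)]
              (fun v => chart_coord (atlas b) (chart_inv (atlas a) v) 0 k) }.

Arguments chart_index {R n} m.
Arguments atlas {R n} m a.

Section Tensors.
Variables (R : realType) (n : nat) (M : manifold R n).

Definition cdom (a : chart_index M) : set 'rV[R]_n :=
  chart_coord (atlas M a) @` chart_dom (atlas M a).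

Definition chart_at (q : M) : chart_index M := projT1 (cid (atlas_cover q)).

(* T a v i = component T_(i 0, ..., i (p-1)), in chart a, at the point of
   coordinates v.  Only the values at v in cdom a are meaningful. *)
Definition components (p : nat) :=
  chart_index M -> 'rV[R]_n -> {ffun 'I_p -> 'I_n} -> R.

(* transition_jacobian a b v i j = d x_a^i / d x_b^j at the point of
   coordinates v in chart b *)
Definition transition_jacobian (a b : chart_index M) (v : 'rV[R]_n)
    (i j : 'I_n) : R :=
  pderiv j (fun w => chart_coord (atlas M a) (chart_inv (atlas M b) w) 0 i) v.

(* smooth sections of the bundle of covariant p-tensors *)
Definition smooth_tensor p (T : components p) : Prop :=
  (forall a i, smooth_on (cdom a) (fun v => T a v i)) /\
  (forall a b v, cdom b v -> chart_dom (atlas M a) (chart_inv (atlas M b) v) ->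
     forall j : {ffun 'I_p -> 'I_n},
       T b v j = \sum_(i : {ffun 'I_p -> 'I_n})
         (\prod_(c < p) transition_jacobian a b v (i c) (j c)) *
         T a (chart_coord (atlas M a) (chart_inv (atlas M b) v)) i).

Definition idx2 (i j : 'I_n) : {ffun 'I_2 -> 'I_n} :=
  [ffun c : 'I_2 => if c == ord0 then i else j].

Definition upd p (i : {ffun 'I_p -> 'I_n}) (a : 'I_p) (k : 'I_n) :
    {ffun 'I_p -> 'I_n} :=
  [ffun c => if c == a then k else i c].

Definition comp2_mx (T : components 2) (a : chart_index M) (v : 'rV[R]_n) :
    'M[R]_n :=
  \matrix_(i, j) T a v (idx2 i j).

Record riemannian_metric := RiemannianMetric {
  metric_comp : components 2;
  metric_smooth : smooth_tensor metric_comp;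
  metric_sym : forall a v i j, cdom a v ->
    metric_comp a v (idx2 i j) = metric_comp a v (idx2 j i);
  metric_pos : forall a v (X : 'rV[R]_n), cdom a v -> X != 0 ->
    0 < (X *m comp2_mx metric_comp a v *m X^T) 0 0 }.

End Tensors.

Section RiemannianGeometry.
Variables (R : realType) (n : nat) (M : manifold R n).
Variable g : riemannian_metric M.
Implicit Types (a : chart_index M) (v X Y : 'rV[R]_n) (i j k l m : 'I_n).

Definition gdn a v i j : R := metric_comp g a v (idx2 i j).

Definition gup a v i j : R := invmx (comp2_mx (metric_comp g) a v) i j.

Definition gprod a v X Y : R := \sum_i \sum_j gdn a v i j * X 0 i * Y 0 j.

(* christoffel a v k i j = Gamma^k_(ij) *)
Definition christoffel a v k i j : R :=
  2^-1 * \sum_l gup a v k l *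
    (pderiv i (fun w => gdn a w j l) v + pderiv j (fun w => gdn a w i l) v
     - pderiv l (fun w => gdn a w i j) v).

(* R_(ijkl) = g(R(d_i, d_j) d_l, d_k), where
   R(X, Y) = [nabla_X, nabla_Y] - nabla_[X, Y]; hence R(X, Y, X, Y) is the
   sectional curvature of orthonormal X, Y *)
Definition riemann a v i j k l : R :=
  \sum_m gdn a v k m *
    (pderiv i (fun w => christoffel a w m j l) v
     - pderiv j (fun w => christoffel a w m i l) v
     + \sum_s (christoffel a v m i s * christoffel a v s j l
               - christoffel a v m j s * christoffel a v s i l)).

Definition ricci a v k l : R :=
  \sum_i \sum_j gup a v i j * riemann a v j k i l.

Definition orthonormal2 a v X Y : Prop :=
  [/\ gprod a v X X = 1, gprod a v Y Y = 1 & gprod a v X Y = 0].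

(* the sectional curvature of the plane spanned by orthonormal X, Y *)
Definition sec a v X Y : R :=
  \sum_i \sum_j \sum_k \sum_l
    riemann a v i j k l * X 0 i * Y 0 j * X 0 k * Y 0 l.

Section TensorOperators.
Variable p : nat.

(* smooth sections of S_0^p M *)
Definition traceless_sym_tensor (T : components M p) : Prop :=
  [/\ smooth_tensor T,
      forall a v (s : {perm 'I_p}) (i : {ffun 'I_p -> 'I_n}), cdom a v ->
        T a v [ffun c => i (s c)] = T a v i
    & forall a v (b c : 'I_p) (i : {ffun 'I_p -> 'I_n}), cdom a v -> b != c ->
        \sum_j \sum_k gup a v j k * T a v (upd (upd i b j) c k) = 0].

(* the Levi-Civita connection; the slot of index 0 is the derivative *)
Definition nabla (T : components M p) : components M p.+1 :=
  fun a v (i0 : {ffun 'I_p.+1 -> 'I_n}) =>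
    let j := i0 ord0 in
    let i := [ffun c : 'I_p => i0 (lift ord0 c)] in
    pderiv j (fun w => T a w i) v
    - \sum_(c < p) \sum_k christoffel a v k j (i c) * T a v (upd i c k).

Definition weitzenboeck (T : components M p) : components M p :=
  fun a v (i : {ffun 'I_p -> 'I_n}) =>
    \sum_(c < p) \sum_j \sum_k
      gup a v j k * ricci a v (i c) j * T a v (upd i c k)
    - \sum_(c < p) \sum_(d < p | c != d) \sum_j \sum_k \sum_l \sum_m
        gup a v j k * gup a v l m * riemann a v (i c) j (i d) l *
        T a v (upd (upd i c k) d m).

(* <T, S> at q, computed in some chart around q; for tensor fields it does
   not depend on the chart *)
Definition inner (T S : components M p) (q : M) : R :=
  let a := chart_at q in
  let v := chart_coord (atlas M a) q in
  \sum_(i : {ffun 'I_p -> 'I_n}) \sum_(j : {ffun 'I_p -> 'I_n})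
    (\prod_(c < p) gup a v (i c) (j c)) * T a v i * S a v j.

End TensorOperators.

Definition borel (T : ptopologicalType) := g_sigma_algebraType (@open T).

(* vol is the Riemannian volume: the (unique) Borel measure on M which in
   every chart has density sqrt (det g) with respect to Lebesgue measure *)
Definition riemannian_volume (vol : {measure set (borel M) -> \bar R}) : Prop :=
  forall a (A : set (borel M)), measurable A -> A `<=` chart_dom (atlas M a) ->
    vol A = iterated_integral (fun v =>
      (\1_(chart_coord (atlas M a) @` A) v * Num.sqrt (\det (comp2_mx (metric_comp g) a v)))%:E).

Variable vol : {measure set (borel M) -> \bar R}.

Definition L2prod p (T S : components M p) : R :=
  \int[vol]_(q in [set: borel M]) inner T S q.

(* chi = nabla^* psi, where nabla^* is the formal L^2-adjoint of
   nabla : C^oo(S_0^p M) -> C^oo(T^*M (x) S_0^p M) *)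
Definition nabla_adjoint p (psi : components M p.+1) (chi : components M p) :
    Prop :=
  traceless_sym_tensor chi /\
  forall eta : components M p, traceless_sym_tensor eta ->
    L2prod chi eta = L2prod psi (nabla eta).

(* psi = (nabla^* nabla - weitzenboeck) phi *)
Definition sampson_laplacian p (phi psi : components M p) : Prop :=
  exists2 chi : components M p, nabla_adjoint (nabla phi) chi &
    forall a v (i : {ffun 'I_p -> 'I_n}), cdom a v ->
      psi a v i = chi a v i - weitzenboeck phi a v i.

Definition sampson_eigenvalue (p : nat) (lambda : R) : Prop :=
  exists phi : components M p,
    [/\ traceless_sym_tensor phi,
        exists a, exists v, exists i : {ffun 'I_p -> 'I_n},
          cdom a v /\ phi a v i != 0
      & sampson_laplacian phi (fun a v (i : {ffun 'I_p -> 'I_n}) => lambda * phi a v i)].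

End RiemannianGeometry.

(* Main.v *)
(* Testing the eigenvalue equation against phi itself gives
   lambda |phi|^2 = |nabla phi|^2 - <R_p phi, phi> after integration, so it is
   enough to show that <R_p phi, phi> <= - p (n + p - 2) beta |phi|^2 at each point
   for phi traceless and symmetric.  Let P(x) = phi(x, ..., x), a harmonic polynomial
   on the tangent space, and let E be the Gaussian expectation.  Integrating by
   parts, E[R(x, grad P, x, grad P)] = E[P Q] where Q is the polynomial of R_p phi,
   and by Wick's formula E[P Q] = p! <phi, R_p phi>, since the traceless phi admits no
   internal contraction.  The left-hand side is nonpositive when sec <= 0.  Apply this
   to R plus beta times the curvature tensor of the unit sphere, whose Weitzenboeck
   operator is multiplication by p (n + p - 2).

   Only finitely many moments enter, so E is built algebraically on polynomials: its
   positivity follows, one variable at a time, from the fact that a nonnegative real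
   polynomial in one variable is a sum of squares. *)
Require Import Defs.
From HB Require Import structures.
From mathcomp Require Import all_boot all_order all_algebra.
From mathcomp Require Import perm polyrcf finmap ring lra.
From mathcomp Require Import all_classical all_reals all_analysis.
From mathcomp Require mpoly.
Import -(notations) mpoly.
Import numFieldNormedType.Exports.

Set Implicit Arguments.
Unset Strict Implicit.
Unset Printing Implicit Defensive.
Import Order.TTheory GRing.Theory Num.Theory.

Local Open Scope classical_set_scope.
Local Open Scope ring_scope.

Local Notation mX i := (mpolyX _ (mnm1 i)).

(** * Gaussian expectation of polynomials *)

(** The pointwise integrand is a nonnegative polynomial in several variables, and such a polynomial
    need not be a sum of squares; hence the one-variable criterion is applied with all other
    coordinates frozen. The constant p (n + p - 2) splits as p (n - 1), from the Ricci term of the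
    unit curvature, plus p (p - 1), one unit for each ordered pair of distinct slots. Two obstacles
    shape the rest. The curvature bound concerns orthonormal pairs, while the argument needs the
    form at x and grad P for every x. The passage uses both antisymmetries of the curvature tensor,
    and the one in the last pair rests on the symmetry of the second partial derivatives of the
    metric. Moreover, the adjoint of nabla is given weakly, through a real-valued integral that
    reads an infinite value as 0. A contradiction therefore requires the integral of - <chi, phi> to
    be finite, which comes from compactness, and positive, which comes from continuity in a fixed
    chart. *)

Section Moments.
Variable R : realFieldType.

(** The moments of the standard normal law, through the recursion that integration by parts imposes:
    0 for odd [k] and [(k-1)!!] for even [k]. *)
Fixpoint gaussian_moment (k : nat) : R :=
  match k with
  | 0 => 1
  | 1 => 0
  | (k'.+1 as k1).+1 => k1%:R * gaussian_moment k'
  end.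

Lemma gaussian_momentS k :
  gaussian_moment k.+1 = k%:R * gaussian_moment k.-1.
Proof. by case: k => [|k] //=; rewrite mul0r. Qed.

Definition gaussian1 (q : {poly R}) : R :=
  \sum_(i < size q) q`_i * gaussian_moment i.

Lemma gaussian1_widen N (q : {poly R}) : (size q <= N)%N ->
  gaussian1 q = \sum_(i < N) q`_i * gaussian_moment i.
Proof.
move=> leN; rewrite /gaussian1 (big_ord_widen _ (fun i => q`_i * gaussian_moment i) leN).
rewrite [RHS](bigID (fun i : 'I_N => (i < size q)%N)) /= [X in _ = _ + X]big1 ?addr0 //.
by move=> i; rewrite -leqNgt => /(nth_default 0) ->; rewrite mul0r.
Qed.

Lemma gaussian1_is_linear : scalar gaussian1.
Proof.
move=> a p q; set N := maxn (size p) (size q).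
have sN : (size (a *: p + q)%R <= N)%N.
  apply: leq_trans (size_polyD _ _) _.
  by rewrite geq_max leq_max (leq_trans (size_scale_leq _ _)) //= leq_maxr.
rewrite (gaussian1_widen sN) (@gaussian1_widen N p) ?leq_maxl //.
rewrite (@gaussian1_widen N q) ?leq_maxr // mulr_sumr -big_split /=.
by apply: eq_bigr => i _; rewrite coefD coefZ mulrDl mulrA.
Qed.
HB.instance Definition _ :=
  GRing.isLinear.Build R {poly R} R *%R gaussian1 gaussian1_is_linear.

Lemma gaussian1_Xn k : gaussian1 'X^k = gaussian_moment k.
Proof.
rewrite (@gaussian1_widen k.+1) ?size_polyXn // big_ord_recr /= coefXn eqxx mul1r.
by rewrite big1 ?add0r // => i _; rewrite coefXn ltn_eqF ?mul0r.
Qed.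

Lemma gaussian1C c : gaussian1 c%:P = c.
Proof.
rewrite (@gaussian1_widen 1) ?size_polyC_leq1 // big_ord1 coefC mulr1 //.
Qed.

Lemma gaussian1_stein q : gaussian1 ('X * q) = gaussian1 q^`().
Proof.
rewrite -[q]coefK poly_def mulr_sumr !linear_sum.
apply: eq_bigr => i _; rewrite /= -scalerAr derivZ !linearZ /= -exprS derivXn linearMn /=.
by rewrite !gaussian1_Xn gaussian_momentS mulr_natl.
Qed.

(* Up to a constant every polynomial is ['X * f - f^`()]; this lowers the
   degree in the next lemma. *)
Lemma hermite_raise (q : {poly R}) :
  exists f c, q = 'X * f - f^`() + c%:P /\ (size f <= (size q).-1)%N.
Proof.
have [m] := ubnP (size q); elim: m q => // m IH q.
case sq: (size q) => [|[|k]] lem.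
- exists 0, 0; move/eqP: sq; rewrite size_poly_eq0 => /eqP ->.
  by rewrite mulr0 deriv0 subr0 addr0 size_poly0.
- exists 0, q`_0; rewrite mulr0 deriv0 subr0 add0r size_poly0; split=> //.
  by apply: size1_polyC; rewrite sq.
(* Here [q] has size [k.+2], so ['X * t] has its leading term, and the derivative of [t] only
   disturbs degree [k.-1]. *)
pose t := lead_coef q *: 'X^k.
have sr : (size (q - ('X * t - t^`()))%R <= k.+1)%N.
  apply/leq_sizeP => j lej; rewrite coefB coefB -scalerAr -exprS derivZ !coefZ.
  rewrite derivXn coefMn !coefXn.
  have -> : (j == k.-1)%N = false by apply: gtn_eqF; exact: leq_ltn_trans (leq_pred k) lej.
  rewrite mul0rn mulr0 subr0; have [->|nej] := eqVneq j k.+1.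
    by rewrite mulr1 lead_coefE sq subrr.
  rewrite mulr0 subr0 nth_default // sq ltn_neqAle eq_sym nej /=; exact: lej.
have [f [c [ef sf]]] := IH _ (leq_ltn_trans sr lem).
exists (t + f), c; split.
  rewrite mulrDr derivD -[LHS](subrK ('X * t - t^`())) ef.
  by ring.
rewrite (leq_trans (size_polyD _ _)) // geq_max /=.
rewrite (leq_trans (size_scale_leq _ _)) ?size_polyXn //=.
by rewrite (leq_trans sf) // (leq_trans (leq_pred _)).
Qed.

Lemma gaussian1_sqr_ge0 (q : {poly R}) : 0 <= gaussian1 (q ^+ 2).
Proof.
have [m] := ubnP (size q); elim: m q => // m IH q sq.
have [f [c [ef sf]]] := hermite_raise q.
have [q0|nq0] := eqVneq q 0; first by rewrite q0 expr0n /= linear0.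
have ltf : (size f < m)%N.
  apply: leq_ltn_trans sf _; rewrite -ltnS prednK //.
  by rewrite lt0n size_poly_eq0.
have adj (u v : {poly R}) : gaussian1 (('X * u - u^`()) * v) = gaussian1 (u * v^`()).
  rewrite mulrBl linearB /= -mulrA gaussian1_stein derivM linearD /=.
  by rewrite addrAC subrr add0r.
have -> : gaussian1 (q ^+ 2) =
          gaussian1 (f ^+ 2) + gaussian1 (f^`() ^+ 2) + c ^+ 2.
  set g := 'X * f - f^`() in ef *.
  have -> : q ^+ 2 = g * (g + (c *+ 2)%:P) + (c ^+ 2)%:P.
    by rewrite ef polyCMn polyC_exp; ring.
  rewrite linearD /= gaussian1C adj derivD derivC addr0 derivB derivM derivX mul1r.
  congr (_ + _).
  have -> : f * (f + 'X * f^`() - f^`()^`()) = f ^+ 2 + ('X * f^`() - f^`()^`()) * f.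
    by ring.
  by rewrite linearD /= adj expr2.
rewrite !addr_ge0 ?sqr_ge0 ?IH //; apply: leq_ltn_trans ltf.
by have [->|/lt_size_deriv/ltnW] := eqVneq f 0; rewrite ?deriv0 ?size_poly0.
Qed.

End Moments.

(** * Positivity of the one-variable expectation *)

Section NonnegativePolynomials.
Variable R : realType.

(** A negative leading coefficient would make the polynomial negative far to the right; the same
    argument for p(-X) covers the left end. *)
Lemma poly_even_growth (p : {poly R}) (m : R) : (1 < size p)%N ->
  (forall x, 0 <= p.[x]) -> exists2 B, 0 <= B & forall x, B <= `|x| -> m <= p.[x].
Proof.
have main (q : {poly R}) : (1 < size q)%N -> (forall x, 0 <= q.[x]) ->
    exists B, forall x, B <= x -> m <= q.[x].
  move=> sq q0; apply: poly_lim_infty => //; rewrite lt_neqAle eq_sym lead_coef_eq0.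
  rewrite -size_poly_gt0 (ltn_trans _ sq) //= leNgt; apply/negP => lq.
  have [||B hB] := @poly_lim_infty _ (- q) 1; rewrite ?lead_coefN ?oppr_gt0 ?size_polyN //.
  by have := hB B (lexx _); rewrite hornerN; have := q0 B; lra.
move=> sp p0; have [B1 h1] := main _ sp p0.
have [||B2 h2] := main (p \Po (- 'X)).
- by rewrite size_comp_poly2 ?size_polyN ?size_polyX.
- by move=> x; rewrite horner_comp.
exists (Num.max 0 (Num.max B1 B2)); first by rewrite le_max lexx.
move=> x; rewrite !ge_max => /and3P[_ b1 b2].
have [x0|x0] := leP 0 x; first by apply: h1; rewrite -(ger0_norm x0).
by have := h2 (- x); rewrite horner_comp !hornerE opprK; apply; rewrite -(ltr0_norm x0).
Qed.

Lemma poly_min_attained (p : {poly R}) : (1 < size p)%N ->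
  (forall x, 0 <= p.[x]) -> exists a, forall x, p.[a] <= p.[x].
Proof.
move=> sp p0; have [B B0 hB] := poly_even_growth p.[0] sp p0.
have cp : {within `[- B, B], continuous (horner p)}.
  by apply: continuous_subspaceT => x; exact: continuous_horner.
have [|a _ ha] := @EVT_min R (horner p) (- B) B _ cp; first by lra.
exists a => x; have [xB|xB] := leP `|x| B.
  by apply: ha; rewrite in_itv /= -ler_norml.
apply: le_trans (hB _ (ltW xB)); apply: ha.
by rewrite in_itv /=; apply/andP; split; lra.
Qed.

Lemma horner_ge0_closure (q : {poly R}) (a : R) :
  (forall e, 0 < e -> exists2 x, `|a - x| < e & 0 <= q.[x]) -> 0 <= q.[a].
Proof.
move=> h; rewrite leNgt; apply/negP => qa.
have cq : horner q x @[x --> a] --> q.[a] by exact: continuous_horner.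
have /nbhs_ballP[e e0 he] : nbhs a [set x | q.[x] < 0].
  by apply: (cvgr_lt _ cq).
by have [x xe] := h e e0; have := he x xe; rewrite /=; lra.
Qed.

(** A zero of a nonnegative polynomial is a double root: the cofactor of X - a is nonpositive to the
    left of a and nonnegative to the right, so it vanishes at a by continuity. *)
Lemma sqr_dvdp_min (p : {poly R}) (a : R) : p.[a] = 0 -> (forall x, 0 <= p.[x]) ->
  exists2 q, p = ('X - a%:P) ^+ 2 * q & forall x, 0 <= q.[x].
Proof.
move=> /eqP pa p0; have [h ph] := factor_theorem _ _ pa.
have ph0 x : 0 <= h.[x] * (x - a) by have := p0 x; rewrite ph !hornerE.
have ha : h.[a] = 0.
  apply/eqP; rewrite eq_le -[_ <= 0]oppr_ge0 -hornerN; apply/andP; split.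
    apply: horner_ge0_closure => e e0; exists (a - e / 2).
      by rewrite opprB addrC subrK ger0_norm; lra.
    by rewrite hornerN; have := ph0 (a - e / 2); rewrite addrAC subrr add0r; nra.
  apply: horner_ge0_closure => e e0; exists (a + e / 2).
    by rewrite opprD addrA subrr add0r normrN ger0_norm; lra.
  by have := ph0 (a + e / 2); rewrite addrAC subrr add0r; nra.
have [q hq] := factor_theorem _ _ (introT eqP ha).
exists q; first by rewrite ph hq; ring.
have q0 x : x != a -> 0 <= q.[x].
  move=> xa; have := ph0 x; rewrite hq !hornerE -mulrA -expr2.
  by rewrite pmulr_lge0 // exprn_even_gt0 //= subr_eq0.
move=> x; have [->|/q0 //] := eqVneq x a.
apply: horner_ge0_closure => e e0; exists (a + e / 2).
  by rewrite opprD addrA subrr add0r normrN ger0_norm; lra.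
by apply: q0; apply/eqP; lra.
Qed.

(** Subtracting the minimum gives p = (X - a)^2 q + p(a) with q nonnegative and smaller. The square
    [r ^+ 2] absorbs the factors (X - a)^2 extracted along the induction, so the decomposition into
    squares is never written out. *)
Lemma gaussian1_ge0_aux (p r : {poly R}) : (forall x, 0 <= p.[x]) ->
  0 <= gaussian1 (p * r ^+ 2).
Proof.
have [m] := ubnP (size p); elim: m p r => // m IH p r sm p0.
have [sp|sp] := leqP (size p) 1.
  have [c pc] : exists c, p = c%:P by exists p`_0; apply: size1_polyC.
  rewrite pc mul_polyC linearZ /=; apply: mulr_ge0 (gaussian1_sqr_ge0 _).
  by have := p0 0; rewrite pc hornerC.
have [a ha] := poly_min_attained sp p0.
have [||q hq q0] := @sqr_dvdp_min (p - p.[a]%:P) a.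
- by rewrite !hornerE subrr.
- by move=> x; rewrite !hornerE subr_ge0.
have -> : p * r ^+ 2 = q * (('X - a%:P) * r) ^+ 2 + p.[a]%:P * r ^+ 2.
  by rewrite -[p in LHS](subrK p.[a]%:P) hq; ring.
rewrite linearD /= mul_polyC linearZ /= addr_ge0 ?mulr_ge0 ?gaussian1_sqr_ge0 //.
apply: IH q0; rewrite -ltnS (leq_trans _ sm) // ltnS.
have [->|qn0] := eqVneq q 0; first by rewrite size_poly0 (ltn_trans _ sp).
have spa : size (p - p.[a]%:P) = size p.
  by rewrite size_polyDl // size_polyN (leq_ltn_trans (size_polyC_leq1 _)).
rewrite -spa hq size_monicM ?monicXn ?monic_exp ?monicXsubC // size_exp_XsubC.
by rewrite addSn.
Qed.

Lemma gaussian1_ge0 (p : {poly R}) : (forall x, 0 <= p.[x]) -> 0 <= gaussian1 p.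
Proof. by move/(gaussian1_ge0_aux 1); rewrite expr1n mulr1. Qed.
End NonnegativePolynomials.

(** * Positive definite matrices and their factorization *)

Definition posdef_mx (R : numDomainType) (n : nat) (A : 'M[R]_n) :=
  A^T = A /\ forall X : 'rV[R]_n, X != 0 -> 0 < (X *m A *m X^T) 0 0.

Lemma posdef_unitmx (R : numFieldType) (n : nat) (A : 'M[R]_n) :
  posdef_mx A -> A \in unitmx.
Proof.
case=> _ pos; rewrite -row_free_unit; apply/row_freeP.
apply/row_freeP; rewrite -kermx_eq0; apply/rowV0P => v /sub_kermxP vA.
by apply/eqP; apply: contraT => /pos; rewrite vA mul0mx mxE ltxx.
Qed.

Lemma posdef_cholesky (R : rcfType) (n : nat) (A : 'M[R]_n) :
  posdef_mx A -> exists e : 'M[R]_n, A = e^T *m e.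
Proof.
elim: n A => [|n IH] A; first by exists 0; rewrite [A]flatmx0 [RHS]flatmx0.
rewrite -[n.+1]/(1 + n)%N in A *; rewrite -[A]submxK.
set u := ulsubmx A; set r := ursubmx A; set l := dlsubmx A; set d := drsubmx A.
case=> symA posA; move: symA; rewrite tr_block_mx => /eq_block_mx [_ lr _ dd].
have lE : l = r^T by rewrite -lr trmxK.
pose a := u 0 0; have ua : u = a%:M by rewrite [u]mx11_scalar.
have a0 : 0 < a.
  have nz : row_mx 1%:M 0 != 0 :> 'rV[R]_(1 + n).
    apply/eqP => /(congr1 lsubmx); rewrite row_mxKl linear0.
    by move/matrixP/(_ 0 0)/eqP; rewrite !mxE oner_eq0.
  have := posA _ nz; rewrite mul_row_block tr_row_mx mul_row_col !trmx0 !mulmx0 addr0.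
  by rewrite !mul0mx !addr0 trmx1 mulmx1 mul1mx.
(* The Schur complement of the corner entry [a]. *)
pose D := d - a^-1 *: (r^T *m r).
have [|e' De] := IH D.
  split=> [|y y0]; first by rewrite linearB /= linearZ /= trmx_mul trmxK dd.
  (* For given [y] this first coordinate minimizes the form of [A], and the minimum is the value of
     the form of [D] at [y]. *)
  have := posA (row_mx (- a^-1 *: (y *m r^T)) y).
  rewrite mul_row_block tr_row_mx mul_row_col ua mul_mx_scalar scalerA mulrN divff ?gt_eqF //.
  rewrite scaleN1r lE addNr mul0mx add0r /D => h.
  have -> : y *m (d - a^-1 *: (r^T *m r)) = - a^-1 *: (y *m r^T) *m r + y *m d.
    by rewrite mulmxBr addrC -scalemxAr scaleNr mulNmx -scalemxAl mulmxA.
  apply: h; apply: contraNneq y0 => h0.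
  by have := congr1 rsubmx h0; rewrite row_mxKr => ->; rewrite linear0.
exists (block_mx (Num.sqrt a)%:M ((Num.sqrt a)^-1 *: r) 0 e').
have s0 : Num.sqrt a != 0 by rewrite gt_eqF // sqrtr_gt0.
rewrite tr_block_mx mulmx_block !trmx0 !mul0mx !mulmx0 !addr0 tr_scalar_mx.
rewrite -scalar_mxM -expr2 sqr_sqrtr ?(ltW a0) // -ua; congr block_mx.
- by rewrite mul_scalar_mx scalerA divff // scale1r.
- by rewrite lE linearZ /= mul_mx_scalar scalerA divff // scale1r.
- rewrite -De /D [(_ *: r)^T]linearZ /= -scalemxAr -scalemxAl scalerA -invfM -expr2 sqr_sqrtr ?(ltW a0) //.
  by rewrite addrC subrK.
Qed.

Lemma posdef_inv_cholesky (R : rcfType) (n : nat) (A : 'M[R]_n) :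
  posdef_mx A -> exists2 e : 'M[R]_n, e \in unitmx & invmx A = e^T *m e.
Proof.
move=> pA; have uA := posdef_unitmx pA; have [e Ae] := posdef_cholesky pA.
have ue : e \in unitmx by move: uA; rewrite Ae unitmx_mul => /andP[].
exists (invmx e)^T; first by rewrite unitmx_tr unitmx_inv.
rewrite trmxK; apply: (can_inj (mulmxK uA)); rewrite mulVmx // {1}Ae.
by rewrite mulmxA -[_ *m _^T]mulmxA -trmx_mul mulmxV // trmx1 mulmx1 mulVmx.
Qed.

(** * Gaussian expectation in several variables *)

Lemma mderivU (n : nat) (R : nzRingType) (i j : 'I_n) :
  mderiv i (mX j : mpoly n R) = (i == j)%:R.
Proof.
rewrite mderivX mnmE eq_sym; have [->|_] := eqVneq i j; last by rewrite scale0r.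
by rewrite scale1r -mpolyX0; congr mpolyX; apply/mnmP => k; rewrite !mnmE subnn.
Qed.

Lemma mderiv_sum (n : nat) (R : nzRingType) (i : 'I_n) (I : Type) (r : seq I)
    (Q : pred I) (F : I -> mpoly n R) :
  mderiv i (\sum_(x <- r | Q x) F x) = \sum_(x <- r | Q x) mderiv i (F x).
Proof. exact: (raddf_sum (mderiv i)). Qed.

Lemma mpoly_closed_ind (n : nat) (R : comNzRingType) (P : mpoly n R -> Prop) :
  (forall c, P (mpolyC n c)) -> (forall i, P (mX i)) ->
  (forall p q, P p -> P q -> P (p + q)) -> (forall p q, P p -> P q -> P (p * q)) ->
  forall p, P p.
Proof.
move=> PC PX PD PM; elim/mpolyind => [|c m p _ _ Pp]; first by rewrite -mpolyC0.
apply: (PD) (Pp); rewrite -mul_mpolyC; apply: (PM) => //; rewrite mpolyXE_id.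
apply: big_ind => // [|i _]; first by rewrite -mpolyC1.
by elim: (m i) => [|k IH]; rewrite ?expr0 ?exprS -?mpolyC1 //; apply: PM.
Qed.

Section GaussianN.
Variables (R : realType) (n : nat).

Definition gaussianN (p : mpoly n R) : R :=
  \sum_(m <- msupp p) mcoeff m p * \prod_i gaussian_moment R (m i).

Lemma sum_msupp_widen (F : multinom n -> R) (p : mpoly n R) (s : seq (multinom n)) :
  uniq s -> {subset msupp p <= s} ->
  \sum_(m <- msupp p) mcoeff m p * F m = \sum_(m <- s) mcoeff m p * F m.
Proof.
move=> us sub; rewrite [RHS](bigID (mem (msupp p))) /= [X in _ = _ + X]big1 ?addr0.
  rewrite -[RHS]big_filter; apply/esym/perm_big/uniq_perm; rewrite ?filter_uniq //.
  by move=> m; rewrite mem_filter andb_idr //; exact: sub.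
by move=> m /memN_msupp_eq0 ->; rewrite mul0r.
Qed.

Lemma gaussianN_is_linear : scalar gaussianN.
Proof.
move=> a p q; set r := a *: p + q.
pose s := undup (msupp p ++ msupp q ++ msupp r).
have us : uniq s by exact: undup_uniq.
have sub t : t \in [:: p; q; r] -> {subset msupp t <= s}.
  rewrite !inE => /or3P[] /eqP -> m hm;
    by rewrite mem_undup !mem_cat hm ?orbT.
rewrite /gaussianN (sum_msupp_widen _ us (sub r _)) ?(sum_msupp_widen _ us (sub p _))
  ?(sum_msupp_widen _ us (sub q _)) ?inE ?eqxx ?orbT //.
rewrite mulr_sumr -big_split /=; apply: eq_bigr => m _.
by rewrite mcoeffD mcoeffZ mulrDl mulrA.
Qed.
HB.instance Definition _ :=
  GRing.isLinear.Build R (mpoly n R) R *%R gaussianN gaussianN_is_linear.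

Lemma gaussianN_X m : gaussianN (mpolyX R m) = \prod_i gaussian_moment R (m i).
Proof. by rewrite /gaussianN msuppX big_seq1 mcoeffX eqxx mul1r. Qed.

Lemma gaussianN1 : gaussianN 1 = 1.
Proof.
by rewrite -mpolyX0 gaussianN_X big1 // => i _; rewrite mnmE.
Qed.

Lemma gaussianN_stein i p : gaussianN (mX i * p) = gaussianN (mderiv i p).
Proof.
elim/mpolyind: p => [|c m p _ _ IH]; first by rewrite mulr0 !linear0.
rewrite mulrDr mderivD !linearD /= IH; congr (_ + _).
rewrite -scalerAr mderivZ !linearZ /= -mpolyXD mderivX linearZ /= !gaussianN_X.
congr (_ * _); rewrite (bigD1 i) //= [in RHS](bigD1 i) //= !mnmE eqxx add1n gaussian_momentS mulrA.
congr (_ * gaussian_moment R _ * _); first by rewrite subn1.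
by apply: eq_bigr => j ji; rewrite !mnmE eq_sym (negPf ji) add0n subn0.
Qed.

(* Only the first k coordinates are integrated out. *)
Definition gaussian_partial (k : nat) (v : 'I_n -> R) (p : mpoly n R) : R :=
  \sum_(m <- msupp p) mcoeff m p *
    \prod_(i < n) (if (i < k)%N then gaussian_moment R (m i) else v i ^+ m i).

(** Integrating out one more coordinate is [gaussian1] of a univariate polynomial [q]. Its value at
    [t] is the previous partial expectation with that coordinate set to [t], hence nonnegative by
    induction. *)
Lemma gaussian_partial_ge0 k p : (forall v, 0 <= meval v p) ->
  (k <= n)%N -> forall v, 0 <= gaussian_partial k v p.
Proof.
move=> p0; elim: k => [_ v|k IH kn v]; first by have := p0 v; rewrite mevalE.
pose i0 := Ordinal kn.
pose rest (m : multinom n) :=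
  \prod_(i < n | i != i0) (if (i < k)%N then gaussian_moment R (m i) else v i ^+ m i).
pose q : {poly R} := \sum_(m <- msupp p) (mcoeff m p * rest m) *: 'X^(m i0).
have -> : gaussian_partial k.+1 v p = gaussian1 q.
  rewrite linear_sum; apply: eq_bigr => m _; rewrite linearZ /= gaussian1_Xn -mulrA.
  congr (_ * _); rewrite (bigD1 i0) //= ltnSn mulrC; congr (_ * _).
  apply: eq_bigr => i ii0; rewrite ltnS leq_eqVlt; case: eqP => //= ik.
  by case/eqP: ii0; apply: val_inj.
apply: gaussian1_ge0 => t.
have := IH (ltnW kn) (fun i => if i == i0 then t else v i); congr (0 <= _).
rewrite horner_sum; apply: eq_bigr => m _; rewrite !hornerE -mulrA; congr (_ * _).
rewrite (bigD1 i0) //= ltnn eqxx mulrC; congr (_ * _).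
by apply: eq_bigr => i /negPf ->.
Qed.

Lemma gaussianN_ge0 p : (forall v, 0 <= meval v p) -> 0 <= gaussianN p.
Proof.
move=> /(@gaussian_partial_ge0 n)/(_ (leqnn n) (fun=> 0)); congr (0 <= _).
by apply: eq_bigr => m _; congr (_ * _); apply: eq_bigr => i _; rewrite ltn_ord.
Qed.

Lemma mderiv_comp_mpoly (lq : n.-tuple (mpoly n R)) (p : mpoly n R) (a : 'I_n) :
  mderiv a (comp_mpoly lq p) =
  \sum_j comp_mpoly lq (mderiv j p) * mderiv a (tnth lq j).
Proof.
elim/mpoly_closed_ind: p => [c|i|p q Hp Hq|p q Hp Hq].
- by rewrite comp_mpolyC mderivC big1 // => j _; rewrite mderivC linear0 mul0r.
- rewrite comp_mpolyXU -tnth_nth (bigD1 i) //= big1 ?addr0 => [|j ji].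
    by rewrite mderivU eqxx rmorph1 mul1r.
  by rewrite mderivU (negPf ji) linear0 mul0r.
- rewrite linearD mderivD Hp Hq -big_split; apply: eq_bigr => j _.
  by rewrite mderivD linearD mulrDl.
- rewrite rmorphM mderivM Hp Hq mulr_suml mulr_sumr -big_split.
  apply: eq_bigr => j _ /=; rewrite mderivM linearD /= !rmorphM /=; ring.
Qed.

End GaussianN.

(* E is the expectation under the centered Gaussian with covariance e^T e. *)
Lemma gaussian_functional (R : realType) (n : nat) (e gi : 'M[R]_n) :
  gi = e^T *m e ->
  exists E : {scalar mpoly n R},
    [/\ E 1 = 1,
        forall i p, E (mX i * p) = \sum_j gi i j * E (mderiv j p)
      & forall p, (forall v, 0 <= meval v p) -> 0 <= E p].
Proof.
move=> gie.
(* The substitution x_i = sum_a e_ai z_a with z standard normal; the covariance of x_i and x_j is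
   then the (i, j) entry of [e^T *m e]. *)
pose lq : n.-tuple (mpoly n R) := [tuple \sum_a e a i *: mX a | i < n].
pose E p := gaussianN (comp_mpoly lq p).
have linE : scalar E by move=> a p q; rewrite /E !linearP.
pose EL := GRing.isLinear.Build R (mpoly n R) R *%R E linE.
pose E' : {scalar mpoly n R} := HB.pack E EL.
exists E'; split=> [|i p|p p0] /=.
- by rewrite /E rmorph1 gaussianN1.
- rewrite /E rmorphM /= comp_mpolyXU -tnth_nth tnth_mktuple mulr_suml linear_sum /=.
  have dlq j a : mderiv a (tnth lq j) = mpolyC n (e a j).
    rewrite tnth_mktuple linear_sum /= (bigD1 a) //= big1 ?addr0 => [|b ba].
      by rewrite mderivZ mderivU eqxx alg_mpolyC.
    by rewrite mderivZ mderivU eq_sym (negPf ba) scaler0.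
  under eq_bigr => a _.
    rewrite -scalerAl linearZ /= gaussianN_stein mderiv_comp_mpoly linear_sum mulr_sumr.
    under eq_bigr => j _ do rewrite dlq [_ * mpolyC _ _]mulrC mul_mpolyC linearZ /= mulrA.
    over.
  rewrite exchange_big /=; apply: eq_bigr => j _; rewrite -mulr_suml gie mxE.
  by congr (_ * _); apply: eq_bigr => a _; rewrite mxE.
- by apply: gaussianN_ge0 => v; rewrite comp_mpoly_meval.
Qed.

Lemma antisym_sum0 (R : numFieldType) (V : lmodType R) (n : nat) (F : 'I_n -> 'I_n -> V) :
  (forall i j, F i j = - F j i) -> \sum_i \sum_j F i j = 0.
Proof.
move=> anti; set S := \sum_i _.
have SN : S = - S.
  rewrite {1}/S exchange_big /= -sumrN; apply: eq_bigr => i _.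
  by rewrite -sumrN; apply: eq_bigr => j _.
have : 2%:R *: S = 0 by rewrite scaler_nat mulr2n {1}SN addNr.
by move/eqP; rewrite scaler_eq0 pnatr_eq0 /= => /eqP.
Qed.

(** * The Weitzenboeck operator on polynomials *)

Section Divergence.
Variables (R : realFieldType) (n : nat).
Variables (gi : 'I_n -> 'I_n -> R) (Rm : 'I_n -> 'I_n -> 'I_n -> 'I_n -> R).
Hypothesis gi_sym : forall i j, gi i j = gi j i.
Hypothesis Rm_anti : forall i j k l, Rm i j k l = - Rm j i k l.
Implicit Types P : mpoly n R.

Definition poly_grad P (l : 'I_n) : mpoly n R := \sum_m gi l m *: mderiv m P.

Definition curvature_poly P : mpoly n R :=
  \sum_i \sum_j \sum_k \sum_l
    Rm i j k l *: (mX i * poly_grad P j * mX k * poly_grad P l).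

Definition ricci_contraction (k l : 'I_n) : R := \sum_i \sum_j gi i j * Rm j k i l.

Definition weitz_order1 (i k : 'I_n) : R := \sum_j gi j k * ricci_contraction i j.

Definition weitz_order2 (i k i' m : 'I_n) : R :=
  \sum_j \sum_l gi j k * gi l m * Rm i j i' l.

(** The differential operator that [weitz_tensor] becomes on polynomials: acting on one slot of a
    tensor is a first-order term, acting on two distinct slots a second-order one. See
    [tensor_poly_weitz]. *)
Definition weitz_poly P : mpoly n R :=
  \sum_i \sum_k weitz_order1 i k *: (mX i * mderiv k P)
  - \sum_i \sum_k \sum_i' \sum_m
      weitz_order2 i k i' m *: (mX i * mX i' * mderiv k (mderiv m P)).

(** The flux A(x) grad P, where A(x) is the bilinear form Rm(x, ., x, .). *)
Let V P (j : 'I_n) : mpoly n R :=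
  \sum_i \sum_k \sum_l Rm i j k l *: (mX i * mX k * poly_grad P l).

Lemma flux_radial0 P : \sum_j mX j * V P j = 0.
Proof.
under eq_bigr => j _ do rewrite /V mulr_sumr.
apply: antisym_sum0 => j i; rewrite !mulr_sumr -sumrN; apply: eq_bigr => k _.
rewrite !mulr_sumr -sumrN; apply: eq_bigr => l _.
rewrite Rm_anti -!scalerAr scaleNr; congr (- (_ *: _)); ring.
Qed.

Lemma flux_gradE P : \sum_j V P j * poly_grad P j = curvature_poly P.
Proof.
rewrite /curvature_poly exchange_big /=; apply: eq_bigr => j _.
rewrite mulr_suml; apply: eq_bigr => i _; rewrite mulr_suml; apply: eq_bigr => k _.
rewrite mulr_suml; apply: eq_bigr => l _; rewrite -scalerAl; congr (_ *: _); ring.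
Qed.

Lemma flux_divergence P : \sum_j \sum_m gi j m *: mderiv m (V P j) = - weitz_poly P.
Proof.
(* The product rule applied to [V]: the derivative falls on the first x in [T1], on the second x in
   [T2] and on grad P in [T3]. [T1] contracts an antisymmetric pair with [gi] and vanishes, [T2] is
   minus the Ricci term, and [T3] is the second-order term. *)
pose T1 := \sum_j \sum_m \sum_k \sum_l (gi j m * Rm m j k l) *: (mX k * poly_grad P l).
pose T2 := \sum_j \sum_m \sum_i \sum_l (gi j m * Rm i j m l) *: (mX i * poly_grad P l).
pose T3 := \sum_j \sum_m \sum_i \sum_k \sum_l (gi j m * Rm i j k l) *:
             (mX i * mX k * mderiv m (poly_grad P l)).
have -> : \sum_j \sum_m gi j m *: mderiv m (V P j) = T1 + T2 + T3.
  rewrite /T1 /T2 /T3 -!big_split /=; apply: eq_bigr => j _.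
  rewrite -!big_split /=; apply: eq_bigr => m _.
  rewrite /V mderiv_sum scaler_sumr /=.
  (* Kronecker deltas are inserted in [T1], and below in [T2], to match the output of the product
     rule term by term. *)
  have -> : \sum_k \sum_l (gi j m * Rm m j k l) *: (mX k * poly_grad P l) =
      \sum_i \sum_k \sum_l (gi j m * Rm i j k l) *: ((m == i)%:R * mX k * poly_grad P l).
    rewrite [RHS](bigD1 m) //= [X in _ = _ + X]big1 ?addr0 => [|i im].
      by apply: eq_bigr => k _; apply: eq_bigr => l _; rewrite eqxx mul1r.
    by apply: big1 => k _; apply: big1 => l _; rewrite eq_sym (negPf im) !mul0r scaler0.
  have -> : \sum_i \sum_l (gi j m * Rm i j m l) *: (mX i * poly_grad P l) =
      \sum_i \sum_k \sum_l (gi j m * Rm i j k l) *: (mX i * (m == k)%:R * poly_grad P l).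
    apply: eq_bigr => i _.
    rewrite [RHS](bigD1 m) //= [X in _ = _ + X]big1 ?addr0 => [|k km].
      by apply: eq_bigr => l _; rewrite eqxx mulr1.
    by apply: big1 => l _; rewrite eq_sym (negPf km) mulr0 !mul0r scaler0.
  rewrite -!big_split /=; apply: eq_bigr => i _.
  rewrite mderiv_sum scaler_sumr -!big_split /=; apply: eq_bigr => k _.
  rewrite mderiv_sum scaler_sumr -!big_split /=; apply: eq_bigr => l _.
  rewrite mderivZ scalerA !mderivM !mderivU -!scalerDr mulrDl; congr (_ *: _).
have -> : T1 = 0.
  apply: antisym_sum0 => j m; rewrite -sumrN; apply: eq_bigr => k _.
  by rewrite -sumrN; apply: eq_bigr => l _; rewrite gi_sym Rm_anti mulrN scaleNr.
have -> : T2 = - \sum_i \sum_k weitz_order1 i k *: (mX i * mderiv k P).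
  rewrite /T2 exchange_big /= -sumrN.
  transitivity (\sum_m \sum_i \sum_j \sum_l (gi j m * Rm i j m l) *: (mX i * poly_grad P l)).
    by apply: eq_bigr => m _; rewrite exchange_big.
  rewrite exchange_big /=; apply: eq_bigr => i _.
  transitivity (\sum_l (- ricci_contraction i l) *: (mX i * poly_grad P l)).
    transitivity (\sum_m \sum_l \sum_j (gi j m * Rm i j m l) *: (mX i * poly_grad P l)).
      by apply: eq_bigr => m _; rewrite exchange_big.
    rewrite exchange_big /=; apply: eq_bigr => l _.
    rewrite /ricci_contraction -sumrN scaler_suml; apply: eq_bigr => m _.
    rewrite -sumrN scaler_suml; apply: eq_bigr => j _.
    by rewrite gi_sym Rm_anti mulrN.
  rewrite -sumrN; under eq_bigr => l _ do rewrite /poly_grad mulr_sumr scaler_sumr.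
  rewrite exchange_big /=; apply: eq_bigr => k _.
  rewrite /weitz_order1 scaler_suml -sumrN; apply: eq_bigr => l _.
  by rewrite -scalerAr scalerA mulNr scaleNr mulrC.
rewrite add0r /weitz_poly opprB addrC; congr (_ - _).
rewrite /T3; under eq_bigr => j _ do rewrite exchange_big /=.
rewrite exchange_big /=; apply: eq_bigr => i _.
rewrite exchange_big /=; apply: eq_bigr => m _.
rewrite exchange_big /=; apply: eq_bigr => k _.
transitivity (\sum_j \sum_l \sum_o (gi j m * gi l o * Rm i j k l) *:
                (mX i * mX k * mderiv m (mderiv o P))).
  apply: eq_bigr => j _; apply: eq_bigr => l _.
  rewrite /poly_grad mderiv_sum mulr_sumr scaler_sumr; apply: eq_bigr => o _ /=.
  by rewrite mderivZ -scalerAr scalerA mulrAC.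
etransitivity; first by apply: eq_bigr => j _; exact: exchange_big.
rewrite exchange_big /=; apply: eq_bigr => o _; rewrite /weitz_order2 scaler_suml.
by apply: eq_bigr => j _; rewrite scaler_suml.
Qed.

(* curvature_poly P is A(grad P, grad P) for the form A(x) = Rm(x, ., x, .), which
   annihilates x: this is integration by parts against the Gaussian, where the
   radial boundary term vanishes, and - weitz_poly P is div (A grad P). *)
Lemma curvature_by_parts (E : {scalar mpoly n R}) P :
  (forall i p, E (mX i * p) = \sum_j gi i j * E (mderiv j p)) ->
  E (curvature_poly P) = E (P * weitz_poly P).
Proof.
move=> stein.
have key j : E (mX j * V P j * P) =
    E ((\sum_m gi j m *: mderiv m (V P j)) * P + V P j * poly_grad P j).
  rewrite -mulrA stein [X in E (X + _)]mulr_suml [X in E (_ + X)]mulr_sumr -big_split linear_sum /=.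
  by apply: eq_bigr => m _; rewrite mderivM -scalerAl -scalerAr -scalerDr linearZ.
have : E ((\sum_j mX j * V P j) * P) = 0 by rewrite flux_radial0 mul0r linear0.
rewrite mulr_suml linear_sum; under eq_bigr => j _ do rewrite key.
rewrite -linear_sum big_split /= -mulr_suml flux_divergence flux_gradE.
by rewrite linearD mulNr linearN /= mulrC => /eqP; rewrite addrC subr_eq0 => /eqP.
Qed.

End Divergence.

Lemma mderiv_prod_seq (n : nat) (R : comNzRingType) (k : 'I_n) (I : eqType) (r : seq I)
    (F : I -> mpoly n R) : uniq r ->
  mderiv k (\prod_(c <- r) F c) =
  \sum_(c <- r) mderiv k (F c) * \prod_(d <- r | d != c) F d.
Proof.
elim: r => [|x r IH] /=; first by rewrite !big_nil -mpolyC1 mderivC.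
case/andP=> xr ur; rewrite !big_cons mderivM IH // eqxx /=; congr (_ * _ + _).
  by rewrite big_seq_cond [RHS]big_seq_cond; apply: eq_bigl => d; rewrite andbT;
    case: (boolP (d \in r)) => //= dr; apply/esym; apply: contraNneq xr => <-.
rewrite mulr_sumr; apply: eq_big_seq => c cr; rewrite big_cons.
case: eqVneq => [xc|_]; first by rewrite xc cr in xr.
by rewrite mulrCA.
Qed.

Lemma mderiv_prod (n : nat) (R : comNzRingType) (k : 'I_n) (I : finType) (S : pred I)
    (F : I -> mpoly n R) :
  mderiv k (\prod_(c | S c) F c) =
  \sum_(c | S c) mderiv k (F c) * \prod_(d | S d && (d != c)) F d.
Proof.
rewrite -big_filter mderiv_prod_seq ?filter_uniq ?index_enum_uniq // big_filter.
by apply: eq_bigr => c _; rewrite big_filter_cond.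
Qed.

(** * Covariant tensors as polynomials *)

Section Upd.
Variables (n p : nat).
Implicit Types (i : {ffun 'I_p -> 'I_n}).

Lemma updE i c k d : upd i c k d = if d == c then k else i d.
Proof. exact: ffunE. Qed.

(** Exchanging the entry in slot [c] with the free index is an involution on pairs. It moves a
    replaced index from the tensor to the monomial that multiplies it. *)
Lemma sum_upd_swap (V : nmodType) (c : 'I_p) (F : {ffun 'I_p -> 'I_n} -> 'I_n -> V) :
  \sum_i \sum_k F i k = \sum_i \sum_k F (upd i c k) (i c).
Proof.
rewrite !pair_big /=.
pose h (x : {ffun 'I_p -> 'I_n} * 'I_n) := (upd x.1 c x.2, x.1 c).
have hK : involutive h.
  case=> i k; rewrite /h /= updE eqxx; congr pair; apply/ffunP => d.
  by rewrite !updE; case: eqP => // ->.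
by rewrite (reindex_inj (inv_inj hK)).
Qed.
End Upd.

Section TensorPoly.
Variables (R : realFieldType) (n p : nat).
Implicit Types (T : {ffun 'I_p -> 'I_n} -> R) (i I : {ffun 'I_p -> 'I_n}).

(** The restriction to a set of slots allows derivatives and Wick contractions to remove slots one
    at a time. *)
Definition monomial_on (S : pred 'I_p) I : mpoly n R := \prod_(c | S c) mX (I c).

Definition tensor_poly T : mpoly n R := \sum_(I : {ffun 'I_p -> 'I_n}) T I *: monomial_on predT I.

Lemma eq_monomial_on (S S' : pred 'I_p) I I' :
  S =1 S' -> (forall c, S c -> I c = I' c) -> monomial_on S I = monomial_on S' I'.
Proof. by move=> eS eI; apply: eq_big => // c Sc; rewrite eI. Qed.

Lemma monomial_onD1 (S : pred 'I_p) I c : S c ->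
  monomial_on S I = mX (I c) * monomial_on [pred d | S d && (d != c)] I.
Proof. by move=> Sc; rewrite /monomial_on (bigD1 c). Qed.

Lemma mderiv_monomial_on k (S : pred 'I_p) I :
  mderiv k (monomial_on S I) =
  \sum_(c | S c) (k == I c)%:R *: monomial_on [pred d | S d && (d != c)] I.
Proof.
rewrite mderiv_prod; apply: eq_bigr => c _.
by rewrite mderivU scaler_nat mulr_natl.
Qed.

Lemma mderiv_tensor_poly k T : mderiv k (tensor_poly T) =
  \sum_(I : {ffun 'I_p -> 'I_n}) \sum_c (T I * (k == I c)%:R) *: monomial_on [pred d | d != c] I.
Proof.
rewrite mderiv_sum; apply: eq_bigr => I _; rewrite mderivZ mderiv_monomial_on scaler_sumr.
by apply: eq_bigr => c _; rewrite scalerA.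
Qed.

Lemma mderiv2_tensor_poly k m T : mderiv k (mderiv m (tensor_poly T)) =
  \sum_(I : {ffun 'I_p -> 'I_n}) \sum_c \sum_(d | c != d) (T I * (k == I c)%:R * (m == I d)%:R) *:
    monomial_on [pred e | (e != c) && (e != d)] I.
Proof.
rewrite mderiv_tensor_poly mderiv_sum; apply: eq_bigr => I _.
rewrite [RHS](exchange_big_dep predT) //= mderiv_sum; apply: eq_bigr => d _.
rewrite mderivZ mderiv_monomial_on scaler_sumr; apply: eq_bigr => c _.
rewrite scalerA -!mulrA [X in _ * X]mulrC; congr (_ *: _).
by apply: eq_monomial_on => // e; rewrite /= andbC.
Qed.

Lemma sum_delta (V : lmodType R) (k0 : 'I_n) (F : 'I_n -> V) (c : 'I_n -> R) :
  \sum_k (c k * (k == k0)%:R) *: F k = c k0 *: F k0.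
Proof.
rewrite (bigD1 k0) //= eqxx mulr1 big1 ?addr0 // => k /negPf ->.
by rewrite mulr0 scale0r.
Qed.

Lemma exchange_big2 (V : nmodType) (A B W : finType) (Q : pred W) (F : A -> B -> W -> V) :
  \sum_a \sum_b \sum_(w | Q w) F a b w = \sum_(w | Q w) \sum_a \sum_b F a b w.
Proof.
rewrite [RHS]exchange_big /=; apply: eq_bigr => a _.
by rewrite [RHS]exchange_big.
Qed.

(** A matrix acting as a derivation on the slots is a linear vector field acting on P. Both sides
    expand to the same sum over an index, a slot of it and a new entry for that slot. *)
Lemma tensor_poly_order1 (M : 'I_n -> 'I_n -> R) T :
  tensor_poly (fun i => \sum_c \sum_k M (i c) k * T (upd i c k)) =
  \sum_i \sum_k M i k *: (mX i * mderiv k (tensor_poly T)).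
Proof.
transitivity (\sum_(I : {ffun 'I_p -> 'I_n}) \sum_c \sum_i (M i (I c) * T I) *:
                (mX i * monomial_on [pred d | d != c] I)).
  rewrite [RHS]exchange_big /= /tensor_poly.
  under [LHS]eq_bigr => I _ do rewrite scaler_suml.
  rewrite [LHS]exchange_big /=; apply: eq_bigr => c _.
  under [LHS]eq_bigr => I _ do rewrite scaler_suml.
  rewrite [LHS](sum_upd_swap c); apply: eq_bigr => I _; apply: eq_bigr => k _.
  have -> : upd (upd I c k) c (I c) = I.
    by apply/ffunP => d; rewrite !updE; case: eqP => // ->.
  rewrite (@monomial_onD1 _ _ c) // updE eqxx; congr (_ *: (_ * _)).
  by apply: eq_monomial_on => // d; rewrite /= updE => /negPf ->.
transitivity (\sum_i \sum_k \sum_(u : {ffun 'I_p -> 'I_n} * 'I_p)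
   (M i k * T u.1 * (k == u.1 u.2)%:R) *: (mX i * monomial_on [pred d | d != u.2] u.1)).
  rewrite [RHS]exchange_big2 [LHS]pair_big /=; apply: eq_bigr => -[I c] _; apply: eq_bigr => i _ /=.
  by rewrite (sum_delta (I c) (fun=> _) (fun k => M i k * T I)).
apply: eq_bigr => i _; apply: eq_bigr => k _.
rewrite mderiv_tensor_poly pair_big mulr_sumr scaler_sumr; apply: eq_bigr => -[I c] _ /=.
by rewrite -scalerAr scalerA mulrA.
Qed.

Lemma tensor_poly_order2 (M : 'I_n -> 'I_n -> 'I_n -> 'I_n -> R) T :
  tensor_poly (fun i => \sum_c \sum_(d | c != d) \sum_k \sum_m
                 M (i c) k (i d) m * T (upd (upd i c k) d m)) =
  \sum_i \sum_k \sum_i' \sum_m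
    M i k i' m *: (mX i * mX i' * mderiv k (mderiv m (tensor_poly T))).
Proof.
pose mon (u : 'I_p * 'I_p) I := monomial_on [pred e | (e != u.1) && (e != u.2)] I.
transitivity (\sum_(I : {ffun 'I_p -> 'I_n}) \sum_(u : 'I_p * 'I_p | u.1 != u.2)
    \sum_i \sum_i' (M i (I u.1) i' (I u.2) * T I) *: (mX i * mX i' * mon u I)).
  rewrite [RHS]exchange_big /= /tensor_poly.
  under [LHS]eq_bigr => I _ do rewrite pair_big_dep /= scaler_suml.
  rewrite [LHS]exchange_big /=; apply: eq_bigr => -[c d] /= cd.
  transitivity (\sum_(I : {ffun 'I_p -> 'I_n}) \sum_k \sum_m
     (M (I c) k (I d) m * T (upd (upd I c k) d m)) *: monomial_on predT I).
    apply: eq_bigr => I _; rewrite scaler_suml; apply: eq_bigr => k _.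
    by rewrite scaler_suml.
  rewrite [LHS](sum_upd_swap c) exchange_big [RHS]exchange_big /=; apply: eq_bigr => i _.
  rewrite [LHS](sum_upd_swap d); apply: eq_bigr => I _; apply: eq_bigr => i' _.
  rewrite (@monomial_onD1 _ _ c) // (@monomial_onD1 _ _ d) /=; last by rewrite eq_sym.
  rewrite mulrA !updE !eqxx [d == c]eq_sym (negPf cd); congr (_ *: (_ * _ * _)).
    congr (M _ _ _ _ * T _); apply/ffunP => e; rewrite !updE.
    by have [->|ed] := eqVneq e d => //; have [->|] := eqVneq e c.
  by apply: eq_monomial_on => // e /= /andP[ec ed]; rewrite !updE (negPf ec) (negPf ed).
transitivity (\sum_i \sum_k \sum_i' \sum_m
  \sum_(w : {ffun 'I_p -> 'I_n} * ('I_p * 'I_p) | w.2.1 != w.2.2)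
   (M i k i' m * T w.1 * (k == w.1 w.2.1)%:R * (m == w.1 w.2.2)%:R) *:
     (mX i * mX i' * mon w.2 w.1)).
  under [RHS]eq_bigr => i _ do under eq_bigr => k _ do rewrite exchange_big2.
  rewrite [RHS]exchange_big2 [LHS]pair_big /=; apply: eq_bigr => -[I [c d]] _ /=.
  apply: eq_bigr => i _; rewrite exchange_big /=; apply: eq_bigr => i' _.
  under [RHS]eq_bigr => k _ do
    rewrite (sum_delta (I d) (fun=> _) (fun m => M i k i' m * T I * (k == I c)%:R)).
  by rewrite (sum_delta (I c) (fun=> _) (fun k => M i k i' (I d) * T I)).
do 4 (apply: eq_bigr => ? _).
rewrite mderiv2_tensor_poly.
under [in RHS]eq_bigr => I _ do rewrite pair_big_dep /=.
rewrite pair_big mulr_sumr scaler_sumr; apply: eq_bigr => -[I [c d]] _ /=.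
by rewrite -scalerAr scalerA !mulrA.
Qed.

End TensorPoly.

(** * Wick's formula for traceless tensors and the algebraic Weitzenboeck operator *)

Section TensorAlgebra.
Variables (R : realFieldType) (n p : nat).
Variable gi : 'I_n -> 'I_n -> R.
Local Notation idx := {ffun 'I_p -> 'I_n}.
Implicit Types (T S : idx -> R) (I J : idx).

Definition tensor_inner T S : R :=
  \sum_(i : idx) \sum_(j : idx) (\prod_c gi (i c) (j c)) * T i * S j.

Definition sym_tensor T :=
  forall (s : {perm 'I_p}) I, T [ffun c => I (s c)] = T I.

Definition traceless_tensor T := forall (b c : 'I_p) I, b != c ->
  \sum_j \sum_k gi j k * T (upd (upd I b j) c k) = 0.

Lemma sum_upd (V : nmodType) (c : 'I_p) (G : idx -> V) :
  (\sum_I G I) *+ n = \sum_I \sum_k G (upd I c k).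
Proof.
rewrite -[RHS](sum_upd_swap c (fun I _ => G I)) -sumrMnl.
by apply: eq_bigr => I _; rewrite sumr_const card_ord.
Qed.

(** Running over all replacements of slots [b] and [c] counts every index n^2 times, and exhibits
    the trace of T over these slots as a factor, since [H] ignores them. *)
Lemma traceless_sum0 b c T (H : idx -> R) : traceless_tensor T -> b != c ->
  (forall I j k, H (upd (upd I b j) c k) = H I) ->
  \sum_I T I * gi (I b) (I c) * H I = 0.
Proof.
move=> trT bc HI; pose G I := T I * gi (I b) (I c) * H I.
(* If some index exists, its entry at [b] shows that [n] is positive, which permits the cancellation
   of both factors [n]. *)
have [I0 _|no] := pickP (@predT idx); last by rewrite big1 // => I; have := no I.
have n0 : (0 < n)%N by exact: leq_ltn_trans (ltn_ord (I0 b)).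
have : (\sum_I G I) *+ n *+ n = 0.
  rewrite (sum_upd c) (sum_upd b); apply: big1 => I _.
  transitivity ((\sum_j \sum_k gi j k * T (upd (upd I b j) c k)) * H I).
    rewrite mulr_suml; apply: eq_bigr => j _; rewrite mulr_suml; apply: eq_bigr => k _.
    by rewrite /G HI !updE !eqxx (negPf bc) [T _ * _]mulrC.
  by rewrite trT // mul0r.
by move/eqP; rewrite !mulrn_eq0 !(gtn_eqF n0) => /eqP.
Qed.

Section Fischer.
Variable E : {scalar mpoly n R}.
Hypothesis E1 : E 1 = 1.
Hypothesis stein : forall i q, E (mX i * q) = \sum_j gi i j * E (mderiv j q).
Local Notation mon := (@monomial_on R n p).

(** One step of Wick's formula: the variable [mX i] is contracted in turn with each remaining
    variable of either monomial. *)
Lemma stein_monomials i (P Q : pred 'I_p) J I :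
  E (mX i * (mon P J * mon Q I)) =
  \sum_(d | P d) gi i (J d) * E (mon [pred c | P c && (c != d)] J * mon Q I)
  + \sum_(d | Q d) gi i (I d) * E (mon P J * mon [pred c | Q c && (c != d)] I).
Proof.
rewrite stein; under eq_bigr => j _ do
  rewrite mderivM !mderiv_monomial_on mulr_suml mulr_sumr linearD !linear_sum /= mulrDr !mulr_sumr.
rewrite big_split /= exchange_big /= [in X in _ + X]exchange_big /=.
congr (_ + _); apply: eq_bigr => d _.
  rewrite -[RHS](@sum_delta _ _ _ (J d) (fun=> E _ : R^o) (gi i)).
  by apply: eq_bigr => j _; rewrite -scalerAl linearZ /= mulrA.
rewrite -[RHS](@sum_delta _ _ _ (I d) (fun=> E _ : R^o) (gi i)).
by apply: eq_bigr => j _; rewrite -scalerAr linearZ /= mulrA.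
Qed.

(* The first k slots of T and S are already contracted with each other. *)
Let fischer (k : nat) T S : R :=
  \sum_(J : idx) \sum_(I : idx) T J * S I * (\prod_(c < p | (c < k)%N) gi (J c) (I c)) *
    E (mon (fun c => k <= c)%N J * mon (fun c => k <= c)%N I).

(** Slot [k] of [T] is contracted by Wick's rule either with a later slot of [T], where the trace
    vanishes, or with one of the [p - k] remaining slots of [S], which are interchangeable by
    symmetry. *)
Lemma fischer_step k T S : (k < p)%N -> sym_tensor S -> traceless_tensor T ->
  fischer k T S = (p - k)%:R * fischer k.+1 T S.
Proof.
move=> kp symS trT; pose c0 := Ordinal kp.
pose A (J I : idx) := \prod_(c < p | (c < k)%N) gi (J c) (I c).
have geS : [pred c : 'I_p | (k <= c)%N && (c != c0)] =1 (fun c : 'I_p => k < c)%N.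
  by move=> c /=; rewrite ltn_neqAle andbC eq_sym.
have step J I : E (mon (fun c => k <= c)%N J * mon (fun c => k <= c)%N I) =
    \sum_(d : 'I_p | (k < d)%N) gi (J c0) (J d) *
       E (mon [pred c : 'I_p | (k < c)%N && (c != d)] J * mon (fun c => k <= c)%N I)
  + \sum_(d : 'I_p | (k <= d)%N) gi (J c0) (I d) *
       E (mon (fun c => k < c)%N J * mon [pred c : 'I_p | (k <= c)%N && (c != d)] I).
  rewrite (@monomial_onD1 _ _ _ (fun c => k <= c)%N J c0) ?leqnn // -mulrA.
  by rewrite (eq_monomial_on (I' := J) _ geS) // stein_monomials.
have -> : fischer k T S =
    \sum_(d : 'I_p | (k < d)%N) \sum_(J : idx) \sum_(I : idx) T J * gi (J c0) (J d) *
      (S I * A J I * E (mon [pred c : 'I_p | (k < c)%N && (c != d)] J * mon (fun c => k <= c)%N I))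
  + \sum_(d : 'I_p | (k <= d)%N) \sum_(J : idx) \sum_(I : idx) T J * S I * A J I * gi (J c0) (I d) *
       E (mon (fun c => k < c)%N J * mon [pred c : 'I_p | (k <= c)%N && (c != d)] I).
  rewrite -[X in _ = X + _]exchange_big2 -[X in _ = _ + X]exchange_big2 -big_split /=.
  apply: eq_bigr => J _; rewrite -big_split /=; apply: eq_bigr => I _.
  rewrite step mulrDr !mulr_sumr; congr (_ + _); apply: eq_bigr => d _; rewrite /A; ring.
(* Contractions inside [T]: apart from [gi (J c0) (J d)], the cofactor of [T J] does not involve the
   slots [c0] and [d] of [J]. *)
rewrite big1 ?add0r => [|d kd]; last first.
  rewrite exchange_big big1 //= => I _; apply: traceless_sum0 => //.
    by rewrite -val_eqE /= ltn_eqF.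
  move=> J j l; congr (_ * _ * E (_ * _)).
    apply: eq_bigr => c ck; rewrite !updE -!val_eqE /= (ltn_eqF ck).
    by rewrite (ltn_eqF (ltn_trans ck kd)).
  apply: eq_monomial_on => // c /= /andP[kc cd].
  by rewrite !updE (negPf cd) -val_eqE /= gtn_eqF.
(* Contractions with slot [d] of [S]: the transposition of [c0] and [d], applied to the index of
   [S], brings each to the case [d = c0]. *)
transitivity (\sum_(d : 'I_p | (k <= d)%N) fischer k.+1 T S).
  apply: eq_bigr => d kd; apply: eq_bigr => J _.
  have swapK : involutive (fun I : idx => [ffun c => I (tperm c0 d c)]).
    by move=> I; apply/ffunP => c; rewrite !ffunE tpermK.
  rewrite (reindex_inj (inv_inj swapK)) /=; apply: eq_bigr => I _; rewrite symS.
  have -> : A J [ffun c => I (tperm c0 d c)] = A J I.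
    apply: eq_bigr => c ck; rewrite ffunE tpermD //; rewrite -val_eqE /= gtn_eqF //.
    exact: leq_trans kd.
  have -> : mon [pred c : 'I_p | (k <= c)%N && (c != d)] [ffun c => I (tperm c0 d c)] =
            mon (fun c : 'I_p => (k < c)%N) I.
    rewrite /monomial_on (reindex_inj (@perm_inj _ (tperm c0 d))) /=.
    apply: eq_big => [c|c _]; last by rewrite ffunE tpermK.
    have [->|c0c] := eqVneq c c0.
      by rewrite tpermL eqxx andbF ltnn.
    have kc : (k != c) by rewrite eq_sym; move: c0c; rewrite -val_eqE.
    have [->|dc] := eqVneq c d.
      by rewrite tpermR leqnn -val_eqE /= [RHS]ltn_neqAle kd andbT.
    have -> : tperm c0 d c = c by rewrite tpermD // eq_sym.
    by rewrite dc andbT ltn_neqAle kc.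
  rewrite ffunE tpermR [in RHS](bigD1 c0) //=.
  have -> : \prod_(c < p | (c < k.+1)%N && (c != c0)) gi (J c) (I c) = A J I.
    by apply: eq_bigl => c; rewrite ltnS [RHS]ltn_neqAle andbC.
  by ring.
rewrite sumr_const mulr_natl; congr (_ *+ _).
by rewrite -sum1_card -(big_geq_mkord k p predT (fun=> 1%N)) sum_nat_const_nat muln1.
Qed.

(* A traceless tensor has no internal Wick contractions, so only the p!
   complete contractions with S survive. *)
Lemma fischer_pairing T S : sym_tensor S -> traceless_tensor T ->
  E (tensor_poly T * tensor_poly S) = p`!%:R * tensor_inner T S.
Proof.
move=> symS trT.
(* The factors [p - j] collected in the first [k] steps multiply to p! / (p - k)!; the identity is
   stated without division. *)
have iter k : (k <= p)%N -> fischer 0 T S * (p - k)`!%:R = p`!%:R * fischer k T S.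
  elim: k => [_|k IH kp]; first by rewrite subn0 mulrC.
  apply: (@mulfI _ (p - k)%:R); first by rewrite pnatr_eq0 subn_eq0 -ltnNge.
  rewrite [RHS]mulrCA -fischer_step // -(IH (ltnW kp)) mulrCA -natrM.
  by rewrite -(subnSK kp) -factS.
have -> : E (tensor_poly T * tensor_poly S) = fischer 0 T S.
  rewrite mulr_suml linear_sum; apply: eq_bigr => J _.
  rewrite mulr_sumr linear_sum; apply: eq_bigr => I _.
  by rewrite -scalerAl -scalerAr scalerA linearZ; congr (_ * _); rewrite big_pred0 ?mulr1.
have := iter p (leqnn p); rewrite subnn mulr1 => ->; congr (_ * _).
apply: eq_bigr => J _; apply: eq_bigr => I _.
have mon1 K : mon (fun c => p <= c)%N K = 1.
  by rewrite /monomial_on big_pred0 // => c; rewrite leqNgt ltn_ord.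
rewrite !mon1 mulr1 E1 mulr1 mulrC mulrA; congr (_ * _ * _).
by apply: eq_bigl => c; rewrite ltn_ord.
Qed.

End Fischer.

(** This is [weitzenboeck] at one point with the inverse metric and the curvature as parameters, so
    that the curvature may be changed to [Rm] plus a multiple of [unit_curvature]. *)
Definition weitz_tensor (Rm : 'I_n -> 'I_n -> 'I_n -> 'I_n -> R) T I : R :=
  \sum_(c < p) \sum_j \sum_k
      gi j k * ricci_contraction gi Rm (I c) j * T (upd I c k)
    - \sum_(c < p) \sum_(d < p | c != d) \sum_j \sum_k \sum_l \sum_m
        gi j k * gi l m * Rm (I c) j (I d) l * T (upd (upd I c k) d m).

Lemma tensor_poly_weitz Rm T :
  tensor_poly (weitz_tensor Rm T) = weitz_poly gi Rm (tensor_poly T).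
Proof.
rewrite /weitz_poly -tensor_poly_order1 -tensor_poly_order2 /tensor_poly.
rewrite -sumrB; apply: eq_bigr => I _; rewrite -scalerBl; congr ((_ - _) *: _).
  apply: eq_bigr => c _; rewrite exchange_big; apply: eq_bigr => k _.
  by rewrite mulr_suml.
apply: eq_bigr => c _; apply: eq_bigr => d _; rewrite exchange_big; apply: eq_bigr => k _.
rewrite /weitz_order2; under [RHS]eq_bigr => m _ do rewrite mulr_suml.
rewrite [RHS]exchange_big /=; apply: eq_bigr => j _.
rewrite exchange_big /=; apply: eq_bigr => m _; rewrite mulr_suml.
by apply: eq_bigr.
Qed.

Lemma weitz_tensorD (Rm Rm' : 'I_n -> 'I_n -> 'I_n -> 'I_n -> R) (b : R) T I :
  weitz_tensor (fun i j k l => Rm i j k l + b * Rm' i j k l) T I =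
  weitz_tensor Rm T I + b * weitz_tensor Rm' T I.
Proof.
rewrite /weitz_tensor mulrBr addrACA -opprD; congr (_ - _).
  rewrite mulr_sumr -big_split; apply: eq_bigr => c _.
  rewrite mulr_sumr -big_split; apply: eq_bigr => j _.
  rewrite mulr_sumr -big_split; apply: eq_bigr => k _ /=.
  have -> : ricci_contraction gi (fun i j k l => Rm i j k l + b * Rm' i j k l) (I c) j =
    ricci_contraction gi Rm (I c) j + b * ricci_contraction gi Rm' (I c) j.
    rewrite /ricci_contraction mulr_sumr -big_split; apply: eq_bigr => i _.
    by rewrite mulr_sumr -big_split; apply: eq_bigr => l _ /=; ring.
  by ring.
rewrite mulr_sumr -big_split; apply: eq_bigr => c _.
rewrite mulr_sumr -big_split; apply: eq_bigr => d _.
rewrite mulr_sumr -big_split; apply: eq_bigr => j _.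
rewrite mulr_sumr -big_split; apply: eq_bigr => k _.
rewrite mulr_sumr -big_split; apply: eq_bigr => l _.
by rewrite mulr_sumr -big_split; apply: eq_bigr => m _ /=; ring.
Qed.

(** * The Weitzenboeck operator of constant curvature *)

Section ConstantCurvature.
Variable gd : 'I_n -> 'I_n -> R.
Hypothesis gd_sym : forall i j, gd i j = gd j i.
Hypothesis gi_sym : forall i j, gi i j = gi j i.
Hypothesis gdK : forall i j, \sum_k gd i k * gi k j = (i == j)%:R.

Definition unit_curvature (i j k l : 'I_n) : R := gd i k * gd j l - gd i l * gd j k.

Lemma unit_curvature_ricci k l :
  ricci_contraction gi unit_curvature k l = (n%:R - 1) * gd k l.
Proof.
have tr : \sum_i \sum_j gi i j * gd j i = n%:R.
  under eq_bigr => i _ do under eq_bigr => j _ do rewrite mulrC gd_sym gi_sym.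
  rewrite (eq_bigr (fun=> 1)) => [|i _]; last by rewrite gdK eqxx.
  by rewrite sumr_const card_ord.
have cr : \sum_i \sum_j gi i j * (gd j l * gd k i) = gd k l.
  transitivity (\sum_j (k == j)%:R * gd j l).
    rewrite exchange_big /=; apply: eq_bigr => j _; rewrite -gdK mulr_suml.
    by apply: eq_bigr => i _; ring.
  rewrite (bigD1 k) //= eqxx mul1r big1 ?addr0 // => j; rewrite eq_sym => /negPf ->.
  by rewrite mul0r.
rewrite mulrBl mul1r -{2}cr -tr mulr_suml -sumrB; apply: eq_bigr => i _.
rewrite mulr_suml -sumrB; apply: eq_bigr => j _; rewrite /unit_curvature; ring.
Qed.

(** The Ricci term gives n - 1 for each of the p slots. For an ordered pair of distinct slots, one
    half of the curvature produces a trace, which is 0, and the other exchanges the two entries,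
    which gives - T by symmetry. With p (p - 1) such pairs the total is p (n - 1) + p (p - 1). *)
Lemma weitz_unit_curvature T I : sym_tensor T -> traceless_tensor T ->
  weitz_tensor unit_curvature T I = p%:R * (n%:R + p%:R - 2) * T I.
Proof.
move=> symT trT; rewrite /weitz_tensor.
have delta i (F : 'I_n -> R) : \sum_k (i == k)%:R * F k = F i.
  rewrite (bigD1 i) //= eqxx mul1r big1 ?addr0 // => k; rewrite eq_sym => /negPf ->.
  by rewrite mul0r.
have -> : \sum_(c < p) \sum_j \sum_k
    gi j k * ricci_contraction gi unit_curvature (I c) j * T (upd I c k) =
    p%:R * (n%:R - 1) * T I.
  rewrite -mulrA mulr_natl -[in RHS](card_ord p) -sumr_const; apply: eq_bigr => c _.
  transitivity ((n%:R - 1) * \sum_k (I c == k)%:R * T (upd I c k)); last first.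
    rewrite delta; congr (_ * T _); apply/ffunP => d; rewrite updE.
    by case: eqP => // ->.
  rewrite exchange_big mulr_sumr; apply: eq_bigr => k _; rewrite -gdK mulr_suml mulr_sumr.
  by apply: eq_bigr => j _; rewrite unit_curvature_ricci; ring.
have pair c d : c != d -> \sum_j \sum_k \sum_l \sum_m
    gi j k * gi l m * unit_curvature (I c) j (I d) l * T (upd (upd I c k) d m) = - T I.
  move=> cd.
  transitivity (gd (I c) (I d) * (\sum_k \sum_m gi k m * T (upd (upd I c k) d m)) -
    \sum_m (I c == m)%:R * \sum_k (I d == k)%:R * T (upd (upd I c k) d m)); last first.
    rewrite trT // mulr0 sub0r delta delta; congr (- _).
    rewrite -(symT (tperm c d) I); congr T; apply/ffunP => e; rewrite !updE ffunE.
    have [->|ed] := eqVneq e d; first by rewrite tpermR.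
    have [->|ec] := eqVneq e c; first by rewrite tpermL.
    by rewrite tpermD // eq_sym.
  rewrite mulr_sumr exchange_big.
  transitivity (\sum_k (\sum_m gd (I c) (I d) * (gi k m * T (upd (upd I c k) d m)) -
     \sum_m (I c == m)%:R * ((I d == k)%:R * T (upd (upd I c k) d m)))); last first.
    rewrite sumrB; congr (_ - _); first by apply: eq_bigr => k _; rewrite mulr_sumr.
    by rewrite exchange_big; apply: eq_bigr => m _; rewrite mulr_sumr.
  apply: eq_bigr => k _; rewrite -sumrB.
  transitivity (\sum_m \sum_j \sum_l gi j k * gi l m * unit_curvature (I c) j (I d) l *
                  T (upd (upd I c k) d m)).
    by rewrite exchange_big2 exchange_big2; do 2 rewrite [RHS]exchange_big.
  apply: eq_bigr => m _.
  transitivity ((gd (I c) (I d) * (\sum_j gi j k * \sum_l gd j l * gi l m) -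
      (\sum_l gd (I c) l * gi l m) * (\sum_j gd (I d) j * gi j k)) *
      T (upd (upd I c k) d m)).
    rewrite mulr_sumr [X in _ - X]mulr_sumr -sumrB mulr_suml; apply: eq_bigr => j _.
    rewrite [X in _ * X - _]mulr_sumr [X in X - _]mulr_sumr.
    rewrite [X in _ - X]mulr_suml -sumrB mulr_suml; apply: eq_bigr => l _.
    by rewrite /unit_curvature (gd_sym j (I d)); ring.
  rewrite !gdK.
  have -> : \sum_j gi j k * \sum_l gd j l * gi l m = gi k m.
    under eq_bigr => j _ do rewrite gdK mulrC eq_sym.
    by rewrite delta gi_sym.
  by ring.
under eq_bigr => c _ do under eq_bigr => d cd do rewrite pair //.
have cardD c : #|[pred d : 'I_p | c != d]| = p.-1.
  rewrite -[in RHS](card_ord p) -(cardC (pred1 c)) card1 add1n /=.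
  by apply: eq_card => d; rewrite !inE eq_sym.
under eq_bigr => c _ do rewrite sumr_const cardD.
(* At [p = 0] the predecessor [p.-1] is truncated, but both sides vanish. *)
rewrite sumr_const card_ord; case: p => [|q]; first by rewrite mulr0n !mul0r subr0.
by rewrite /= -mulrnA mulNrn opprK -[X in _ + X]mulr_natr natrM -natr1; ring.
Qed.
End ConstantCurvature.

End TensorAlgebra.

(** * Sectional curvature as a biquadratic form *)

Section Biquadratic.
Variables (R : rcfType) (n : nat) (A : 'M[R]_n).
Variable Rm : 'I_n -> 'I_n -> 'I_n -> 'I_n -> R.
Hypothesis A_posdef : posdef_mx A.
Hypothesis Rm_anti12 : forall i j k l, Rm i j k l = - Rm j i k l.
Hypothesis Rm_anti34 : forall i j k l, Rm i j k l = - Rm i j l k.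
Implicit Types X Y : 'rV[R]_n.

Definition mx_prod X Y : R := \sum_i \sum_j A i j * X 0 i * Y 0 j.

Definition biquad X Y : R :=
  \sum_i \sum_j \sum_k \sum_l Rm i j k l * X 0 i * Y 0 j * X 0 k * Y 0 l.

Lemma mx_prodE X Y : mx_prod X Y = (X *m A *m Y^T) 0 0.
Proof.
rewrite !mxE /mx_prod exchange_big /=; apply: eq_bigr => j _.
rewrite !mxE mulr_suml; apply: eq_bigr => i _; ring.
Qed.

Lemma mx_prod_gt0 X : X != 0 -> 0 < mx_prod X X.
Proof. by rewrite mx_prodE; apply: A_posdef.2. Qed.

(** Each antisymmetry makes Rm(X, ., X, .) vanish when X is put in the corresponding free slot. *)
Lemma biquad_shear X Y (t : R) : biquad X (Y + t *: X) = biquad X Y.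
Proof.
pose B (Y W : 'rV[R]_n) : R := \sum_i \sum_j \sum_k \sum_l Rm i j k l * X 0 i * Y 0 j * X 0 k * W 0 l.
have B34 Z : B Z X = 0.
  rewrite /B; apply: big1 => i _; apply: big1 => j _; apply: (@antisym_sum0 _ R^o) => k l.
  by rewrite Rm_anti34; ring.
have B12 Z : B X Z = 0.
  rewrite /B; apply: (@antisym_sum0 _ R^o) => i j; rewrite -sumrN; apply: eq_bigr => k _.
  by rewrite -sumrN; apply: eq_bigr => l _; rewrite Rm_anti12; ring.
rewrite /biquad -/(B _ _) -/(B Y Y).
transitivity (B Y Y + t * B X (Y + t *: X) + t * B Y X); last first.
  by rewrite B12 B34 !mulr0 !addr0.
rewrite /B !mulr_sumr -!big_split; apply: eq_bigr => i _ /=.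
rewrite !mulr_sumr -!big_split; apply: eq_bigr => j _ /=.
rewrite !mulr_sumr -!big_split; apply: eq_bigr => k _ /=.
rewrite !mulr_sumr -!big_split; apply: eq_bigr => l _ /=.
by rewrite !mxE; ring.
Qed.

Lemma biquadZ X Y (s t : R) : biquad (s *: X) (t *: Y) = s ^+ 2 * t ^+ 2 * biquad X Y.
Proof.
rewrite /biquad mulr_sumr; apply: eq_bigr => i _; rewrite mulr_sumr; apply: eq_bigr => j _.
rewrite mulr_sumr; apply: eq_bigr => k _; rewrite mulr_sumr; apply: eq_bigr => l _.
by rewrite !mxE; ring.
Qed.

Lemma biquad0r X : biquad X 0 = 0.
Proof. by rewrite -[0](scale0r X) -[X in biquad X _](scale1r X) biquadZ expr0n mulr0 mul0r. Qed.

(** Gram-Schmidt: shearing replaces Y by its component W orthogonal to X, and normalizing X and W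
    only divides the value by a positive factor. The form vanishes when X or W is 0. *)
Lemma biquad_le0 :
  (forall X Y, mx_prod X X = 1 -> mx_prod Y Y = 1 -> mx_prod X Y = 0 -> biquad X Y <= 0) ->
  forall X Y, biquad X Y <= 0.
Proof.
move=> ortho X Y; have [->|X0] := eqVneq X 0.
  by rewrite -[X in biquad X _](scale0r Y) -[X in biquad _ X](scale1r Y) biquadZ expr0n !mul0r.
have prodZ (s t : R) Z W : mx_prod (s *: Z) (t *: W) = s * t * mx_prod Z W.
  by rewrite !mx_prodE linearZ /= -scalemxAr -!scalemxAl !mxE; ring.
have pX := mx_prod_gt0 X0.
pose t := mx_prod X Y / mx_prod X X; pose W := Y - t *: X.
have XW : mx_prod X W = 0.
  have -> : mx_prod X W = mx_prod X Y - t * mx_prod X X.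
    rewrite /mx_prod mulr_sumr -sumrB; apply: eq_bigr => i _.
    by rewrite mulr_sumr -sumrB; apply: eq_bigr => j _; rewrite !mxE; ring.
  by rewrite /t divfK ?gt_eqF // subrr.
have -> : biquad X Y = biquad X W by rewrite -(biquad_shear X W t) /W subrK.
have [->|W0] := eqVneq W 0; first by rewrite biquad0r.
have pW := mx_prod_gt0 W0.
have unit Z : 0 < mx_prod Z Z ->
    mx_prod ((Num.sqrt (mx_prod Z Z))^-1 *: Z) ((Num.sqrt (mx_prod Z Z))^-1 *: Z) = 1.
  by move=> pZ; rewrite prodZ -invfM -expr2 sqr_sqrtr ?ltW // mulVf ?gt_eqF.
have := ortho _ _ (unit _ pX) (unit _ pW); rewrite prodZ XW mulr0 => /(_ erefl).
by rewrite biquadZ pmulr_rle0 // mulr_gt0 ?exprn_gt0 ?invr_gt0 ?sqrtr_gt0.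
Qed.

End Biquadratic.

Lemma tensor_innerC (R : realFieldType) (n p : nat) (gi : 'I_n -> 'I_n -> R)
    (T S : {ffun 'I_p -> 'I_n} -> R) : (forall i j, gi i j = gi j i) ->
  tensor_inner gi T S = tensor_inner gi S T.
Proof.
move=> gi_sym; rewrite /tensor_inner exchange_big; apply: eq_bigr => i _; apply: eq_bigr => j _.
by rewrite mulrAC; congr (_ * _ * _); apply: eq_bigr.
Qed.

Lemma tensor_innerDl (R : realFieldType) (n p : nat) (gi : 'I_n -> 'I_n -> R)
    (b : R) (T T' S : {ffun 'I_p -> 'I_n} -> R) :
  tensor_inner gi (fun i => T i + b * T' i) S =
  tensor_inner gi T S + b * tensor_inner gi T' S.
Proof.
rewrite /tensor_inner mulr_sumr -big_split; apply: eq_bigr => i _ /=.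
by rewrite mulr_sumr -big_split; apply: eq_bigr => j _ /=; ring.
Qed.

(* The Weitzenboeck operator of the unit curvature tensor is the scalar
   p (n + p - 2), so the bound follows from positivity for Rm + beta * unit. *)
Lemma weitz_inner_le (R : realType) (n p : nat) (A : 'M[R]_n)
    (Rm : 'I_n -> 'I_n -> 'I_n -> 'I_n -> R) (beta : R)
    (T : {ffun 'I_p -> 'I_n} -> R) :
  let gi := fun_of_matrix (invmx A) in
  posdef_mx A -> (forall i j k l, Rm i j k l = - Rm j i k l) ->
  (forall X Y : 'rV[R]_n,
     biquad (fun i j k l => Rm i j k l + beta * unit_curvature A i j k l) X Y <= 0) ->
  sym_tensor T -> traceless_tensor gi T -> sym_tensor (weitz_tensor gi Rm T) ->
  tensor_inner gi (weitz_tensor gi Rm T) T <=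
    - (p%:R * (n%:R + p%:R - 2) * beta) * tensor_inner gi T T.
Proof.
move=> gi pA anti sec symT trT symW.
have [e _ gie] := posdef_inv_cholesky pA.
have [E [E1 stein Epos]] := gaussian_functional gie.
have A_sym i j : A i j = A j i by rewrite -[A in LHS]pA.1 mxE.
have gi_sym i j : gi i j = gi j i.
  by rewrite /gi -[in LHS]pA.1 -trmx_inv mxE.
have gdK i j : \sum_k A i k * gi k j = (i == j)%:R.
  by have /matrixP/(_ i j) := mulmxV (posdef_unitmx pA); rewrite !mxE.
pose Rb i j k l := Rm i j k l + beta * unit_curvature A i j k l.
have Rb_anti i j k l : Rb i j k l = - Rb j i k l.
  by rewrite /Rb anti /unit_curvature; ring.
pose c : R := p%:R * (n%:R + p%:R - 2).
have WE i : weitz_tensor gi Rb T i = weitz_tensor gi Rm T i + beta * c * T i.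
  by rewrite weitz_tensorD weitz_unit_curvature // mulrA.
(* [fischer_pairing] is applied below with [T] as the traceless factor and this tensor as the
   symmetric one. *)
have symWb : sym_tensor (weitz_tensor gi Rb T).
  by move=> s i; rewrite !WE symW symT.
(* At a point [v] this polynomial takes the value of the biquadratic form at [v] and the gradient of
   P there. *)
have : E (curvature_poly gi Rb (tensor_poly T)) <= 0.
  rewrite -oppr_ge0 -linearN; apply: Epos => v; rewrite mevalN oppr_ge0.
  set P := tensor_poly T.
  have := sec (\row_i v i) (\row_j meval v (poly_grad gi P j)); congr (_ <= 0).
  rewrite /biquad /curvature_poly raddf_sum; apply: eq_bigr => i _ /=.
  rewrite raddf_sum; apply: eq_bigr => j _; rewrite raddf_sum; apply: eq_bigr => k _ /=.
  rewrite raddf_sum; apply: eq_bigr => l _ /=.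
  by rewrite mevalZ !mevalM !mevalXU !mxE !mulrA.
rewrite (curvature_by_parts gi_sym Rb_anti _ stein) -tensor_poly_weitz.
rewrite (fischer_pairing E1 stein symWb trT) pmulr_rle0 ?ltr0n ?fact_gt0 //.
rewrite tensor_innerC //.
have -> : tensor_inner gi (weitz_tensor gi Rb T) T =
  tensor_inner gi (fun i => weitz_tensor gi Rm T i + beta * c * T i) T.
  by congr tensor_inner; apply/funext.
rewrite tensor_innerDl /c => h; rewrite -subr_le0; apply: le_trans h.
by rewrite le_eqVlt; apply/orP; left; apply/eqP; ring.
Qed.

(** * Symmetries of the curvature tensor *)

Section Schwarz.
Variables (R : realType) (n : nat).
Implicit Types (f : 'rV[R]_n -> R) (v : 'rV[R]_n).
Local Notation e_ i := (delta_mx 0 i : 'rV[R]_n).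

Lemma is_derive_line f v e (s : R) : derivable f (s *: e + v) e ->
  is_derive s 1 (fun t : R => f (t *: e + v) : R^o) ('D_e f (s *: e + v)).
Proof.
move=> df.
have eqF : (fun h : R => h^-1 *:
    (((fun t : R => f (t *: e + v) : R^o) \o shift s) (h *: (1 : R)) - f (s *: e + v)))
  = (fun h : R => h^-1 *: ((f \o shift (s *: e + v)) (h *: e) - f (s *: e + v))).
  by apply/funext => h /=; rewrite [_%:A]mulr1 scalerDl addrA.
by apply: DeriveDef; rewrite /derivable /derive eqF.
Qed.

Lemma is_derive_translate f a v e df : is_derive (a + v) e f df ->
  is_derive v e (fun w => f (a + w) : R^o) df.
Proof.
case=> + <-; rewrite /derivable /derive; set q := (fun h => _) => dq.
suff eqF : (fun h : R => h^-1 *: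
    (((fun w => f (a + w) : R^o) \o shift v) (h *: e) - f (a + v))) = q.
  by apply: DeriveDef; rewrite /derivable /derive eqF.
by apply/funext => h; rewrite /q /= addrCA.
Qed.

Lemma line_mean_value f v e (h : R) : 0 < h ->
  (forall s : R, 0 <= s <= h -> derivable f (s *: e + v) e) ->
  exists2 c, 0 < c < h & f (h *: e + v) - f v = h * 'D_e f (c *: e + v).
Proof.
move=> h0 df.
have [|||c] := @MVT R (fun t => f (t *: e + v)) (fun s => 'D_e f (s *: e + v)) 0 h.
- exact: h0.
- move=> s; rewrite in_itv /= => /andP[s0 sh].
  by apply: is_derive_line; apply: df; rewrite !ltW.
- apply: derivable_within_continuous => s; rewrite in_itv /= => sh.
  by have [] := is_derive_line (df _ sh).
rewrite in_itv /= => ch; rewrite scale0r add0r subr0 mulrC => ->.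
by exists c.
Qed.

(** The mean value theorem is applied twice: along [e_ i] to the increment w -> f(w + h e_j) - f(w),
    then along [e_ j] to the i-th partial derivative of f. *)
Lemma mixed_difference (D : set 'rV[R]_n) f v (i j : 'I_n) (h : R) : 0 < h ->
  (forall w, D w -> derivable f w (e_ i)) ->
  (forall w, D w -> derivable (pderiv i f) w (e_ j)) ->
  (forall s t, 0 <= s <= h -> 0 <= t <= h -> D (s *: e_ i + (t *: e_ j + v))) ->
  exists c d, [/\ 0 < c < h, 0 < d < h &
    f (h *: e_ i + (h *: e_ j + v)) - f (h *: e_ j + v) - (f (h *: e_ i + v) - f v) =
    h ^+ 2 * pderiv j (pderiv i f) (c *: e_ i + (d *: e_ j + v))].
Proof.
move=> h0 df ddf hD.
pose f2 w := f (h *: e_ j + w) - f w.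
have D0 s : 0 <= s <= h -> D (s *: e_ i + v).
  by move=> hs; have := hD s 0 hs; rewrite scale0r add0r; apply; rewrite lexx ltW.
have D1 s : 0 <= s <= h -> D (h *: e_ j + (s *: e_ i + v)).
  by move=> hs; rewrite addrCA; apply: hD => //; rewrite lexx ltW.
have df2 s : 0 <= s <= h -> is_derive (s *: e_ i + v) (e_ i) f2
     (pderiv i f (h *: e_ j + (s *: e_ i + v)) - pderiv i f (s *: e_ i + v)).
  move=> hs; apply: is_deriveB; last exact/derivableP/df/D0.
  exact/is_derive_translate/derivableP/df/D1.
have [c ch Ec] := @line_mean_value f2 v (e_ i) h h0 (fun s hs => @ex_derive _ _ _ _ _ _ _ (df2 s hs)).
have ch' : 0 <= c <= h by case/andP: ch => *; rewrite !ltW.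
have [|d dh Ed] := @line_mean_value (pderiv i f) (c *: e_ i + v) (e_ j) h h0.
  by move=> s hs; apply: ddf; rewrite addrCA; apply: hD.
exists c, d; split; [exact: ch|exact: dh|].
have Ei := @derive_val _ _ _ _ _ _ _ (df2 c ch'); rewrite Ed in Ei.
rewrite Ei in Ec.
have alg (x y z t : R) : x - y - (z - t) = x - z - (y - t) by ring.
rewrite alg (addrCA (h *: e_ i)) (addrCA (c *: e_ i)) expr2 -mulrA.
exact: Ec.
Qed.

(** The second difference quotient is symmetric in [i] and [j], and equals either mixed partial
    derivative at some point near [v]. Continuity of both at [v] then identifies their values. *)
Lemma Ck2_mixed_partials (D : set 'rV[R]_n) f v (i j : 'I_n) : open D -> D v ->
  Ck 2 D f -> pderiv i (pderiv j f) v = pderiv j (pderiv i f) v.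
Proof.
have tri (x y q e : R) : `|x - q| < e / 2 -> `|y - q| < e / 2 -> `|y - x| <= e.
  by move=> hx hy; have := ler_distD q y x; rewrite (distrC q x); lra.
move=> oD Dv [_ C2].
have df k w : D w -> derivable f w (e_ k) by move=> Dw; apply: (C2 k).1.
have ddf k l w : D w -> derivable (pderiv k f) w (e_ l).
  by move=> Dw; have [_ [_ /(_ l) [+ _]]] := C2 k; exact.
have cdd k l : pderiv l (pderiv k f) w @[w --> v] --> pderiv l (pderiv k f) v.
  by have [_ [_ /(_ l) [_ +]]] := C2 k; exact.
have near_v : forall e : R, 0 < e -> exists2 r : R, 0 < r & forall w, `|w - v| < r ->
    [/\ D w, `|pderiv i (pderiv j f) v - pderiv i (pderiv j f) w| < e &
     `|pderiv j (pderiv i f) v - pderiv j (pderiv i f) w| < e].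
  move=> e e0.
  have /nbhs_ballP[r r0 hr] : \forall w \near v, [/\ D w,
     `|pderiv i (pderiv j f) v - pderiv i (pderiv j f) w| < e &
     `|pderiv j (pderiv i f) v - pderiv j (pderiv i f) w| < e].
    have A1 : \forall w \near v, D w by exact: open_nbhs_nbhs.
    have A2 : \forall w \near v, `|pderiv i (pderiv j f) v - pderiv i (pderiv j f) w| < e.
      exact: (cvgrPdist_lt _ _).1 (cdd j i) e e0.
    have A3 : \forall w \near v, `|pderiv j (pderiv i f) v - pderiv j (pderiv i f) w| < e.
      exact: (cvgrPdist_lt _ _).1 (cdd i j) e e0.
    by apply: filterS3 A1 A2 A3 => w Dw h1 h2; split; [exact: Dw|exact: h1|exact: h2].
  exists r; first exact: r0.
  by move=> w wv; apply: hr; rewrite -ball_normE /= distrC.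
(* With steps of at most r / 3 the displacement is at most 2 r / 3 in the sup norm. *)
have near_box (r : R) k l s t : 0 < r -> 0 <= s <= r / 3 -> 0 <= t <= r / 3 ->
    `|s *: e_ k + (t *: e_ l + v) - v| < r.
  move=> r0 /andP[s0 sr] /andP[t0 tr]; rewrite addrA addrK.
  have ne (m : 'I_n) : `|e_ m| <= 1.
    rewrite [leLHS]/Num.norm /= mx_normrE; apply: bigmax_le => // -[a b] _ /=.
    by rewrite !mxE ger0_norm ?ler0n // lern1 leq_b1.
  apply: le_lt_trans (ler_normD _ _) _; rewrite !normrZ !ger0_norm //.
  have := ler_pM s0 (normr_ge0 _) sr (ne k); have := ler_pM t0 (normr_ge0 _) tr (ne l).
  by lra.
apply/eqP; rewrite -subr_eq0 -normr_le0; apply/ler_addgt0Pl => e e0; rewrite addr0.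
have [|r r0 hr] := near_v (e / 2); first by lra.
have h0 : 0 < r / 3 by lra.
have hh : (r / 3) ^+ 2 != 0 by apply: expf_neq0; rewrite gt_eqF.
have box k l s t : 0 <= s <= r / 3 -> 0 <= t <= r / 3 -> D (s *: e_ k + (t *: e_ l + v)).
  by move=> hs ht; have [] := hr _ (near_box _ k l _ _ r0 hs ht).
have [c [d [ch dh E1]]] := mixed_difference h0 (df i) (ddf i j) (box i j).
have [c' [d' [ch' dh' E2]]] := mixed_difference h0 (df j) (ddf j i) (box j i).
have weak (x : R) : 0 < x < r / 3 -> 0 <= x <= r / 3 by case/andP => *; rewrite !ltW.
have [_ _ n1] := hr _ (near_box _ i j _ _ r0 (weak _ ch) (weak _ dh)).
have [_ n2 _] := hr _ (near_box _ j i _ _ r0 (weak _ ch') (weak _ dh')).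
have alg (x y z t : R) : x - y - (z - t) = x - z - (y - t) by ring.
rewrite (addrCA ((r / 3) *: e_ j)) alg E1 in E2.
rewrite -(mulfI hh E2) in n2.
exact: tri n1 n2.
Qed.
End Schwarz.

(** * Determinants and adjugates in a class of functions closed under sums and products *)

Section FunctionAlgebra.
Variables (R : comNzRingType) (U : Type) (P : (U -> R) -> Prop).
Hypothesis P_cst : forall c, P (fun=> c).
Hypothesis P_add : forall f g, P f -> P g -> P (fun w => f w + g w).
Hypothesis P_mul : forall f g, P f -> P g -> P (fun w => f w * g w).

Lemma closed_sum (I : Type) (r : seq I) (Q : pred I) (F : I -> U -> R) :
  (forall i, P (F i)) -> P (fun w => \sum_(i <- r | Q i) F i w).
Proof.
move=> PF; elim: r => [|i r IH].
  by rewrite (_ : (fun w => _) = fun=> 0) //; apply/funext => w; rewrite big_nil.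
rewrite (_ : (fun w => _) = fun w => (if Q i then F i w else 0) + \sum_(i <- r | Q i) F i w).
  by apply: P_add => //; case: (Q i).
by apply/funext => w; rewrite big_cons; case: (Q i); rewrite ?add0r.
Qed.

Lemma closed_prod (I : Type) (r : seq I) (Q : pred I) (F : I -> U -> R) :
  (forall i, P (F i)) -> P (fun w => \prod_(i <- r | Q i) F i w).
Proof.
move=> PF; elim: r => [|i r IH].
  by rewrite (_ : (fun w => _) = fun=> 1) //; apply/funext => w; rewrite big_nil.
rewrite (_ : (fun w => _) = fun w => (if Q i then F i w else 1) * \prod_(i <- r | Q i) F i w).
  by apply: P_mul => //; case: (Q i).
by apply/funext => w; rewrite big_cons; case: (Q i); rewrite ?mul1r.
Qed.

(** Applied with [P] being differentiability or continuity at a point, in order to reach the inverse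
    metric as adjugate over determinant. *)
Lemma closed_det (n : nat) (M : U -> 'M[R]_n) :
  (forall i j, P (fun w => M w i j)) -> P (fun w => \det (M w)).
Proof.
by move=> PM; apply: closed_sum => s; apply: P_mul => //; apply: closed_prod.
Qed.

Lemma closed_adj (n : nat) (M : U -> 'M[R]_n) i j :
  (forall i j, P (fun w => M w i j)) -> P (fun w => (\adj (M w)) i j).
Proof.
move=> PM; rewrite (_ : (fun w => _) = fun w => (-1) ^+ (j + i) * \det (row' j (col' i (M w)))).
  apply: P_mul => //; apply: closed_det => k l.
  by rewrite (_ : (fun w => _) = fun w => M w (lift j k) (lift i l)) //; apply/funext => w; rewrite !mxE.
by apply/funext => w; rewrite mxE.
Qed.
End FunctionAlgebra.

(** * Antisymmetry of the curvature in its last two indices *)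

Section CurvatureAlgebra.
Variables (R : realFieldType) (n : nat).
Local Notation I := 'I_n.
(** In the application [low k i j] is Gamma_(k, ij), while [dGam i m j l] and [dlow i k j l] are the
    i-th partial derivatives of Gamma^m_(jl) and Gamma_(k, jl). Then [dlowE] is the product rule for
    [lowE], with the derivative of the metric expressed by nabla g = 0. *)
Variables (gd : I -> I -> R) (Gam low : I -> I -> I -> R) (dGam dlow : I -> I -> I -> I -> R).
Hypothesis gd_sym : forall i j, gd i j = gd j i.
Hypothesis lowE : forall k i j, \sum_m gd k m * Gam m i j = low k i j.
Hypothesis dlowE : forall i k j l, \sum_m gd k m * dGam i m j l =
  dlow i k j l - \sum_m (low k i m + low m i k) * Gam m j l.

Let curv i j k l := \sum_m gd k m *
  (dGam i m j l - dGam j m i l + \sum_s (Gam m i s * Gam s j l - Gam m j s * Gam s i l)).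

(** Lowering the derivatives by [dlowE] creates the products [low k i m * Gam m j l], which cancel
    the quadratic part of the definition; only the products with [low m i k] survive. *)
Lemma curvature_lowered i j k l : curv i j k l =
  dlow i k j l - dlow j k i l - \sum_m (low m i k * Gam m j l - low m j k * Gam m i l).
Proof.
transitivity (\sum_m gd k m * dGam i m j l - \sum_m gd k m * dGam j m i l
  + \sum_s (low k i s * Gam s j l - low k j s * Gam s i l)).
  transitivity (\sum_m gd k m * dGam i m j l - \sum_m gd k m * dGam j m i l
    + \sum_m \sum_s gd k m * (Gam m i s * Gam s j l - Gam m j s * Gam s i l)).
    rewrite -sumrB -big_split; apply: eq_bigr => m _ /=.
    by rewrite mulrDr mulrBr mulr_sumr.
  congr (_ + _); rewrite exchange_big; apply: eq_bigr => s _ /=.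
  rewrite -(lowE k i s) -(lowE k j s) !mulr_suml -sumrB; apply: eq_bigr => m _; ring.
rewrite !dlowE.
have split_sum (x y z : I -> R) :
    \sum_m (x m + y m) * z m = \sum_m x m * z m + \sum_m y m * z m.
  by rewrite -big_split; apply: eq_bigr => m _; rewrite mulrDl.
by rewrite !split_sum !sumrB; ring.
Qed.

(** The products in [curvature_lowered] are pairings of two Christoffel symbols by the metric.
    [cross] is the symmetry of that pairing, and makes them antisymmetric in k and l; the assumption
    does the same for the derivatives. *)
Lemma curvature_anti34 i j k l :
  dlow i k j l + dlow i l j k = dlow j k i l + dlow j l i k ->
  curv i j k l = - curv i j l k.
Proof.
have cross s t m u : \sum_r low r s t * Gam r m u = \sum_r low r m u * Gam r s t.
  under eq_bigr => r _ do rewrite -lowE mulr_suml.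
  under [RHS]eq_bigr => r _ do rewrite -lowE mulr_suml.
  rewrite exchange_big /=; apply: eq_bigr => q _; apply: eq_bigr => r _.
  by rewrite gd_sym; ring.
move=> mixed; rewrite !curvature_lowered !sumrB (cross i l j k) (cross j l i k).
by lra.
Qed.
End CurvatureAlgebra.

Section Metric.
Variables (R : realType) (n : nat) (M : manifold R n) (g : riemannian_metric M).
Implicit Types (a : chart_index M) (v : 'rV[R]_n).
Local Notation e_ i := (delta_mx 0 i : 'rV[R]_n).
Local Notation G := (comp2_mx (metric_comp g)).

Lemma cdom_open a : open (cdom a).
Proof. exact: chart_image_open. Qed.

Lemma near_cdom a v : cdom a v -> \forall w \near v, cdom a w.
Proof. by move=> av; apply: open_nbhs_nbhs; split => //; exact: cdom_open. Qed.

Lemma metric_posdef a v : cdom a v -> posdef_mx (G a v).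
Proof.
move=> av; split=> [|X X0]; last exact: metric_pos.
by apply/matrixP => i j; rewrite !mxE Defs.metric_sym.
Qed.

Lemma gdnE a v i j : gdn g a v i j = G a v i j.
Proof. by rewrite mxE. Qed.

Lemma gdn_sym a v i j : cdom a v -> gdn g a v i j = gdn g a v j i.
Proof. exact: Defs.metric_sym. Qed.

Lemma gdn_gup a v i j : cdom a v -> \sum_k gdn g a v i k * gup g a v k j = (i == j)%:R.
Proof.
move=> av; have /matrixP/(_ i j) := mulmxV (posdef_unitmx (metric_posdef av)).
by rewrite !mxE => <-; apply: eq_bigr => k _; rewrite gdnE.
Qed.

Lemma gdn_smooth a i j : smooth_on (cdom a) (fun v => gdn g a v i j).
Proof. exact: (metric_smooth g).1. Qed.

Lemma gupE a v i j : cdom a v -> gup g a v i j = (\det (G a v))^-1 * (\adj (G a v)) i j.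
Proof.
by move=> av; rewrite /gup /invmx (posdef_unitmx (metric_posdef av)) mxE.
Qed.

Lemma det_metric_neq0 a v : cdom a v -> \det (G a v) != 0.
Proof. by move/metric_posdef/posdef_unitmx; rewrite unitmxE unitfE. Qed.

Lemma gdn_derivable a v i j k : cdom a v -> derivable (fun w => gdn g a w i j) v (e_ k).
Proof. by move=> av; have [_ /(_ k) [+ _]] := gdn_smooth a i j 1; exact. Qed.

Lemma gdn_derivable2 a v i j k l : cdom a v ->
  derivable (pderiv l (fun w => gdn g a w i j)) v (e_ k).
Proof.
by move=> av; have [_ /(_ l) [_ [_ /(_ k) [+ _]]]] := gdn_smooth a i j 2; exact.
Qed.

Let derivable_cstf v e (c : R) : derivable (fun=> c : R^o) v e.
Proof. exact: derivable_cst. Qed.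
Let derivable_addf v e (f h : 'rV[R]_n -> R) :
  derivable f v e -> derivable h v e -> derivable (fun w => f w + h w) v e.
Proof. exact: derivableD. Qed.
Let derivable_mulf v e (f h : 'rV[R]_n -> R) :
  derivable f v e -> derivable h v e -> derivable (fun w => f w * h w) v e.
Proof. exact: derivableM. Qed.

Lemma gup_derivable a v i j k : cdom a v -> derivable (fun w => gup g a w i j) v (e_ k).
Proof.
move=> av; have DG s t : derivable (fun w => G a w s t) v (e_ k).
  rewrite (_ : (fun w => _) = fun w => gdn g a w s t); first exact: gdn_derivable.
  by apply/funext => w; rewrite gdnE.
(* The formula adjugate over determinant is available on [cdom a], a neighbourhood of [v]. *)
apply: near_eq_derivable (_ : derivable (fun w => (\det (G a w))^-1 * (\adj (G a w)) i j) _ _).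
  by apply: filterS (near_cdom av) => w aw; rewrite gupE.
apply: derivable_mulf; last first.
  exact: (@closed_adj _ _ (fun f : 'rV[R]_n -> R => derivable f v (e_ k)) (@derivable_cstf v _)
    (@derivable_addf v _) (@derivable_mulf v _) _ (G a) i j DG).
apply: derivableV; first exact: det_metric_neq0.
exact: (@closed_det _ _ (fun f : 'rV[R]_n -> R => derivable f v (e_ k)) (@derivable_cstf v _)
  (@derivable_addf v _) (@derivable_mulf v _) _ (G a) DG).
Qed.

Lemma christoffel_derivable a v k i j m : cdom a v ->
  derivable (fun w => christoffel g a w k i j) v (e_ m).
Proof.
move=> av; apply: derivable_mulf; first exact: derivable_cstf.
apply: (@closed_sum _ _ (fun f : 'rV[R]_n -> R => derivable f v (e_ m)) (@derivable_cstf v _)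
  (@derivable_addf v _)) => l.
apply: derivable_mulf; first exact: gup_derivable.
apply: derivable_addf; first by apply: derivable_addf; exact: gdn_derivable2.
exact/derivableN/gdn_derivable2.
Qed.

(* lowered a v k i j = Gamma_(k, ij), the index k being lowered with g *)
Definition lowered a v k i j : R := 2^-1 *
  (pderiv i (fun w => gdn g a w j k) v + pderiv j (fun w => gdn g a w i k) v
   - pderiv k (fun w => gdn g a w i j) v).

Lemma pderiv_near k (f h : 'rV[R]_n -> R) a v : cdom a v ->
  (forall w, cdom a w -> f w = h w) -> pderiv k f v = pderiv k h v.
Proof. by move=> av fh; apply: near_eq_derive; apply: filterS (near_cdom av). Qed.

Lemma pderiv_gdn_sym a v i j k : cdom a v ->
  pderiv k (fun w => gdn g a w i j) v = pderiv k (fun w => gdn g a w j i) v.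
Proof. by move=> av; apply: (pderiv_near _ av) => w; exact: gdn_sym. Qed.

Lemma lowered_christoffel a v k i j : cdom a v ->
  \sum_m gdn g a v k m * christoffel g a v m i j = lowered a v k i j.
Proof.
move=> av; pose F l := pderiv i (fun w => gdn g a w j l) v + pderiv j (fun w => gdn g a w i l) v
     - pderiv l (fun w => gdn g a w i j) v.
transitivity (2^-1 * \sum_l (\sum_m gdn g a v k m * gup g a v m l) * F l).
  rewrite mulr_sumr; under [RHS]eq_bigr => l _ do rewrite mulr_suml mulr_sumr.
  rewrite exchange_big /=; apply: eq_bigr => m _; rewrite /christoffel.
  by rewrite mulrCA !mulr_sumr; apply: eq_bigr => l _; rewrite /F; ring.
rewrite (bigD1 k) //= gdn_gup // eqxx mul1r big1 ?addr0 // => l lk.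
by rewrite gdn_gup // eq_sym (negPf lk) mul0r.
Qed.

(** This is nabla g = 0 in coordinates. *)
Lemma lowered_metric_compat a v i k l : cdom a v ->
  lowered a v k i l + lowered a v l i k = pderiv i (fun w => gdn g a w k l) v.
Proof.
move=> av; rewrite /lowered (pderiv_gdn_sym l k _ av) (pderiv_gdn_sym i k _ av) (pderiv_gdn_sym i l _ av).
by field.
Qed.

Lemma lowered_derivable a v k i j m : cdom a v ->
  derivable (fun w => lowered a w k i j) v (e_ m).
Proof.
move=> av; apply: derivable_mulf; first exact: derivable_cstf.
apply: derivable_addf; first by apply: derivable_addf; exact: gdn_derivable2.
exact/derivableN/gdn_derivable2.
Qed.

Lemma sum_gdn_pderiv_christoffel a v i k j l : cdom a v ->
  \sum_m gdn g a v k m * pderiv i (fun w => christoffel g a w m j l) v =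
  pderiv i (fun w => lowered a w k j l) v -
  \sum_m (lowered a v k i m + lowered a v m i k) * christoffel g a v m j l.
Proof.
move=> av; apply/eqP; rewrite eq_sym subr_eq -big_split /=; apply/eqP.
pose F m w := gdn g a w k m * christoffel g a w m j l.
have -> : pderiv i (fun w => lowered a w k j l) v = pderiv i (\sum_m F m) v.
  apply: (pderiv_near _ av) => w aw; rewrite -lowered_christoffel //.
  by rewrite fct_sumE.
rewrite /pderiv derive_sum => [|m]; last first.
  by apply: derivable_mulf; [exact: gdn_derivable|exact: christoffel_derivable].
apply: eq_bigr => m _; rewrite lowered_metric_compat //.
rewrite /F (deriveM (f := fun w => gdn g a w k m) (g := fun w => christoffel g a w m j l)) //.
- by rewrite /pderiv; congr (_ + _); rewrite mulrC.
- exact: gdn_derivable.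
- exact: christoffel_derivable.
Qed.

Lemma riemann_anti12 a v i j k l : riemann g a v i j k l = - riemann g a v j i k l.
Proof.
rewrite /riemann -sumrN; apply: eq_bigr => m _; rewrite -mulrN; congr (_ * _).
rewrite opprD opprB; congr (_ + _).
by rewrite -sumrN; apply: eq_bigr => s _; rewrite opprB.
Qed.

(** By [lowered_metric_compat] the assumption of [curvature_anti34] says that the partial
    derivatives in i and j of g_kl commute. *)
Lemma riemann_anti34 a v i j k l : cdom a v ->
  riemann g a v i j k l = - riemann g a v i j l k.
Proof.
move=> av; apply: (curvature_anti34 (low := lowered a v)
  (dlow := fun i k j l => pderiv i (fun w => lowered a w k j l) v)
  (dGam := fun i m j l => pderiv i (fun w => christoffel g a w m j l) v)).
- by move=> s t; exact: gdn_sym.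
- by move=> s t u; exact: lowered_christoffel.
- by move=> s t u w; exact: sum_gdn_pderiv_christoffel.
have dd s t : pderiv s (fun w => lowered a w k t l) v + pderiv s (fun w => lowered a w l t k) v =
    pderiv s (pderiv t (fun w => gdn g a w k l)) v.
  transitivity (pderiv s ((fun w => lowered a w k t l) + (fun w => lowered a w l t k)) v).
    by rewrite /pderiv deriveD //; exact: lowered_derivable.
  by apply: (pderiv_near _ av) => w aw; rewrite -lowered_metric_compat.
have schwarz := @Ck2_mixed_partials R n (cdom a) _ v i j (@cdom_open a) av (gdn_smooth a k l 2).
exact: etrans (dd i j) (etrans schwarz (esym (dd j i))).
Qed.

End Metric.

(** * Inner products of tensors *)

Lemma prod_sum_ffun2 (R : comNzRingType) (n p : nat) (F : 'I_p -> 'I_n -> 'I_n -> R) :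
  \prod_c \sum_s \sum_t F c s t =
  \sum_(i : {ffun 'I_p -> 'I_n}) \sum_(j : {ffun 'I_p -> 'I_n}) \prod_c F c (i c) (j c).
Proof.
rewrite bigA_distr_bigA; apply: eq_bigr => i _.
by rewrite bigA_distr_bigA.
Qed.

Section Transform.
Variables (R : realFieldType) (n p : nat).
Local Notation idx := {ffun 'I_p -> 'I_n}.
Implicit Types (J : 'I_n -> 'I_n -> R) (T S : idx -> R).

(** The transformation law in [smooth_tensor] when [J] is a Jacobian; with the entries of a frame
    for [J] it gives the components in that frame. *)
Definition transform_tensor J T : idx -> R :=
  fun j => \sum_(i : idx) (\prod_(c < p) J (i c) (j c)) * T i.

Lemma tensor_inner_transform J ga gb T S :
  (forall k l, \sum_s \sum_t J k s * gb s t * J l t = ga k l) ->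
  tensor_inner gb (transform_tensor J T) (transform_tensor J S) = tensor_inner ga T S.
Proof.
move=> gaE; rewrite /tensor_inner /transform_tensor.
transitivity (\sum_(i : idx) \sum_(j : idx) \sum_(k : idx) \sum_(l : idx)
   (\prod_c (J (k c) (i c) * gb (i c) (j c) * J (l c) (j c))) * (T k * S l)).
  apply: eq_bigr => i _; apply: eq_bigr => j _; rewrite -mulrA mulr_suml mulr_sumr.
  apply: eq_bigr => k _; rewrite !mulr_sumr; apply: eq_bigr => l _.
  by rewrite !big_split /=; ring.
transitivity (\sum_(k : idx) \sum_(l : idx) (\sum_(i : idx) \sum_(j : idx)
   (\prod_c (J (k c) (i c) * gb (i c) (j c) * J (l c) (j c)))) * (T k * S l)).
  rewrite (@exchange_big2 _ _ _ _ predT); apply: eq_bigr => k _.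
  rewrite (@exchange_big2 _ _ _ _ predT); apply: eq_bigr => l _.
  by rewrite mulr_suml; apply: eq_bigr => i _; rewrite mulr_suml.
apply: eq_bigr => k _; apply: eq_bigr => l _.
rewrite -(prod_sum_ffun2 (fun c s t => J (k c) s * gb s t * J (l c) t)) mulrA.
by congr (_ * _ * _); apply: eq_bigr => c _; rewrite gaE.
Qed.

Lemma transform_tensorK J J' T : (forall i k, \sum_j J i j * J' j k = (i == k)%:R) ->
  transform_tensor J' (transform_tensor J T) =1 T.
Proof.
move=> JK k; rewrite /transform_tensor.
transitivity (\sum_(i : idx) (\prod_c \sum_s J (i c) s * J' s (k c)) * T i).
  under eq_bigr => j _ do rewrite mulr_sumr.
  rewrite exchange_big; apply: eq_bigr => i _ /=.
  rewrite bigA_distr_bigA mulr_suml; apply: eq_bigr => j _.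
  by rewrite mulrA big_split; congr (_ * _); rewrite mulrC.
rewrite (bigD1 k) //= big1 => [|c _]; last by rewrite JK eqxx.
rewrite mul1r big1 ?addr0 // => i ik.
have /existsP[c ic] : [exists c, i c != k c].
  rewrite -negb_forall; apply: contra ik => /forallP eqik.
  by apply/eqP/ffunP => c; apply/eqP.
by rewrite (bigD1 c) //= JK (negPf ic) !mul0r.
Qed.
End Transform.

Section Positivity.
Variables (R : rcfType) (n p : nat) (A : 'M[R]_n).
Hypothesis A_posdef : posdef_mx A.
Local Notation gi := (fun_of_matrix (invmx A)).
Implicit Types T : {ffun 'I_p -> 'I_n} -> R.

(** The rows of [e] form an orthonormal frame, because the inverse metric is [e^T *m e]. *)
Lemma tensor_inner_frame : exists2 e : 'M[R]_n, e \in unitmx &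
  forall T, tensor_inner gi T T = \sum_i transform_tensor (fun k s => e s k) T i ^+ 2.
Proof.
have [e ue gie] := posdef_inv_cholesky A_posdef; exists e => // T.
rewrite -(@tensor_inner_transform _ _ _ (fun k s => e s k) _ (fun s t => (s == t)%:R)) => [|k l].
  rewrite /tensor_inner; apply: eq_bigr => i _; rewrite (bigD1 i) //= big1 => [|c _]; last by rewrite eqxx.
  rewrite mul1r big1 ?addr0 ?expr2 // => j ij.
  have /existsP[c ic] : [exists c, i c != j c].
    rewrite -negb_forall; apply: contra ij => /forallP eqij.
    by apply/eqP/ffunP => c; apply/esym/eqP.
  by rewrite (bigD1 c) //= (negPf ic) !mul0r.
rewrite gie mxE; apply: eq_bigr => s _; rewrite mxE (bigD1 s) //= eqxx mulr1 big1 ?addr0 //.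
by move=> t; rewrite eq_sym => /negPf ->; rewrite mulr0 mul0r.
Qed.

Lemma tensor_inner_ge0 T : 0 <= tensor_inner gi T T.
Proof.
have [e _ ->] := tensor_inner_frame; apply: sumr_ge0 => i _; exact: sqr_ge0.
Qed.

Lemma tensor_inner_gt0 T i : T i != 0 -> 0 < tensor_inner gi T T.
Proof.
move=> Ti; rewrite lt_neqAle tensor_inner_ge0 andbT eq_sym.
have [e ue ->] := tensor_inner_frame; apply: contraNneq Ti => S0.
have J0 j : transform_tensor (fun k s => e s k) T j = 0.
  apply/eqP; rewrite -(sqrf_eq0); move/eqP: S0; rewrite psumr_eq0 => [|k _]; last exact: sqr_ge0.
  by move/allP/(_ j (mem_index_enum j)).
rewrite -(@transform_tensorK _ _ _ (fun k s => e s k) (fun s k => invmx e k s) T _ i).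
  by apply/eqP; apply: big1 => j _; rewrite J0 mulr0.
move=> k l; have /matrixP/(_ l k) := mulVmx ue; rewrite !mxE eq_sym => <-.
by apply: eq_bigr => s _; rewrite mulrC.
Qed.
End Positivity.

Section ChartIndependence.
Variables (R : realType) (n : nat) (M : manifold R n) (g : riemannian_metric M).
Implicit Types (a b : chart_index M) (v : 'rV[R]_n).
Local Notation G := (comp2_mx (metric_comp g)).
Local Notation coord a q := (chart_coord (atlas M a) q).

(** [inner] chooses a chart separately at each point, so continuity has to be argued in one fixed
    chart. *)
Definition chart_inner p (T S : components M p) a v : R :=
  tensor_inner (gup g a v) (T a v) (S a v).

Lemma innerE p (T S : components M p) q :
  inner g T S q = chart_inner T S (chart_at q) (coord (chart_at q) q).
Proof. by []. Qed.

Lemma sum_idx2 (F : 'I_n -> 'I_n -> R) :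
  \sum_(i : {ffun 'I_2 -> 'I_n}) F (i ord0) (i ord_max) = \sum_s \sum_t F s t.
Proof.
rewrite pair_big /= (reindex (fun u : 'I_n * 'I_n => idx2 u.1 u.2)) /=.
  by apply: eq_bigr => -[s t] _; rewrite !ffunE.
exists (fun i => (i ord0, i ord_max)) => [[s t] _|i _]; first by rewrite /= !ffunE.
apply/ffunP => c; rewrite ffunE /=; case: eqP => [->//|c0]; congr (i _).
by apply: val_inj; case: c c0 => -[|[|m]] //= h []; apply: val_inj.
Qed.

Lemma metric_transition a b q (J := \matrix_(i, j) transition_jacobian a b (coord b q) i j) :
  chart_dom (atlas M a) q -> chart_dom (atlas M b) q ->
  G b (coord b q) = J^T *m G a (coord a q) *m J.
Proof.
move=> aq bq; apply/matrixP => i j.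
have bv : cdom b (coord b q) by exists q.
have qb : chart_inv (atlas M b) (coord b q) = q by exact: chart_coordK.
have := (metric_smooth g).2 a b _ bv; rewrite qb => /(_ aq (idx2 i j)) E.
rewrite [LHS]mxE E.
pose F s t := J s i * J t j * G a (coord a q) s t.
transitivity (\sum_s \sum_t F s t).
  rewrite -sum_idx2; apply: eq_bigr => k _; rewrite !big_ord_recl big_ord0 mulr1 /F !mxE.
  have -> : lift ord0 ord0 = ord_max :> 'I_2 by apply: val_inj.
  rewrite !ffunE /=; congr (_ * metric_comp g a _ _).
  apply/ffunP => c; rewrite ffunE; case: eqP => [->//|c0]; congr (k _).
  by apply: val_inj; case: c c0 => -[|[|m]] //= h []; apply: val_inj.
rewrite mxE exchange_big; apply: eq_bigr => t _ /=; rewrite [in RHS]mxE mulr_suml.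
apply: eq_bigr => s _; rewrite [in RHS]mxE /F; ring.
Qed.

(** The relation G_b = J^T G_a J between invertible matrices already forces J to be invertible, and
    inverting it gives the law for the inverse metric. *)
Lemma gup_transition a b q (J := transition_jacobian a b (coord b q)) k l :
  chart_dom (atlas M a) q -> chart_dom (atlas M b) q ->
  \sum_s \sum_t J k s * gup g b (coord b q) s t * J l t = gup g a (coord a q) k l.
Proof.
move=> aq bq; pose Jm := \matrix_(i, j) J i j.
have GE := metric_transition aq bq; rewrite -/J -/Jm in GE.
have uGa : G a (coord a q) \in unitmx by apply/posdef_unitmx/metric_posdef; exists q.
have uGb : G b (coord b q) \in unitmx by apply/posdef_unitmx/metric_posdef; exists q.
have uJ : Jm \in unitmx by move: uGb; rewrite GE unitmx_mul => /andP[].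
have uJT : Jm^T \in unitmx by rewrite unitmx_tr.
have inv : Jm *m invmx (G b (coord b q)) *m Jm^T = invmx (G a (coord a q)).
  apply: (can_inj (mulmxK uGa)); rewrite mulVmx //.
  apply: (can_inj (mulmxK uJ)); rewrite mul1mx -!mulmxA [Jm^T *m _]mulmxA -GE.
  by rewrite mulVmx // mulmx1.
have /matrixP/(_ k l) := inv; rewrite -/(gup g a (coord a q) k l) => <-.
rewrite mxE exchange_big; apply: eq_bigr => t _ /=; rewrite mxE mulr_suml.
by apply: eq_bigr => s _; rewrite /gup !mxE.
Qed.

Lemma chart_inner_indep p (T S : components M p) a b q :
  smooth_tensor T -> smooth_tensor S ->
  chart_dom (atlas M a) q -> chart_dom (atlas M b) q ->
  chart_inner T S a (coord a q) = chart_inner T S b (coord b q).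
Proof.
move=> sT sS aq bq; have bv : cdom b (coord b q) by exists q.
have qb : chart_inv (atlas M b) (coord b q) = q by exact: chart_coordK.
have tr (X : components M p) : smooth_tensor X -> X b (coord b q) =
    transform_tensor (transition_jacobian a b (coord b q)) (X a (coord a q)).
  move=> sX; apply/funext => j; have := sX.2 a b _ bv.
  by rewrite qb => /(_ aq j).
rewrite /chart_inner (tr T sT) (tr S sS).
by apply/esym/tensor_inner_transform => k l; apply: gup_transition.
Qed.

Lemma inner_chart p (T S : components M p) a q :
  smooth_tensor T -> smooth_tensor S -> chart_dom (atlas M a) q ->
  inner g T S q = chart_inner T S a (coord a q).
Proof.
move=> sT sS aq; rewrite innerE; apply: chart_inner_indep => //.
by rewrite /chart_at; case: cid.
Qed.

End ChartIndependence.

(** * Continuity in a chart and the pointwise curvature bound *)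

Section Pointwise.
Variables (R : realType) (n : nat) (M : manifold R n) (g : riemannian_metric M).
Implicit Types (a : chart_index M) (v : 'rV[R]_n).
Local Notation G := (comp2_mx (metric_comp g)).

Let cts v (f : 'rV[R]_n -> R) : Prop := f w @[w --> v] --> f v.

Let cts_cst v (c : R) : cts v (fun=> c).
Proof. by rewrite /cts; apply: cvg_cst; exact: nbhs_filter. Qed.

Let cts_add v f h : cts v f -> cts v h -> cts v (fun w => f w + h w).
Proof. by move=> cf ch; exact: (cvgD cf ch). Qed.

Let cts_mul v f h : cts v f -> cts v h -> cts v (fun w => f w * h w).
Proof. by move=> cf ch; exact: (cvgM cf ch). Qed.

Lemma metric_continuous a v s t : cdom a v -> cts v (fun w => G a w s t).
Proof.
move=> av; rewrite (_ : (fun w => _) = fun w => gdn g a w s t).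
  exact: (gdn_smooth g a s t 0%N v av).
by apply/funext => w; rewrite gdnE.
Qed.

Lemma det_metric_continuous a v : cdom a v ->
  \det (G a w) @[w --> v] --> \det (G a v).
Proof.
move=> av; have CG s t := @metric_continuous a v s t av.
exact: (@closed_det _ _ (cts v) (@cts_cst v) (@cts_add v) (@cts_mul v) _ (G a) CG).
Qed.

Lemma gup_continuous a v i j : cdom a v -> gup g a w i j @[w --> v] --> gup g a v i j.
Proof.
move=> av; rewrite gupE //.
have near_gup :
    {near v, (fun w => (\det (G a w))^-1 * (\adj (G a w)) i j) =1 (fun w => gup g a w i j)}.
  by apply: filterS (near_cdom av) => w aw; rewrite gupE.
apply: cvg_trans (near_eq_cvg near_gup) _.
apply: cvgM; last first.
  have CG s t := @metric_continuous a v s t av.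
  exact: (@closed_adj _ _ (cts v) (@cts_cst v) (@cts_add v) (@cts_mul v) _ (G a) i j CG).
by apply: cvgV; [exact: det_metric_neq0|exact: det_metric_continuous].
Qed.

Lemma chart_inner_continuous p (T S : components M p) a v :
  smooth_tensor T -> smooth_tensor S -> cdom a v ->
  chart_inner g T S a w @[w --> v] --> chart_inner g T S a v.
Proof.
move=> sT sS av; apply: (@closed_sum _ _ (cts v) (@cts_cst v) (@cts_add v)) => i.
apply: (@closed_sum _ _ (cts v) (@cts_cst v) (@cts_add v)) => j.
apply: (@cts_mul v); last exact: (sS.1 a j 0%N v av).
apply: (@cts_mul v); last exact: (sT.1 a i 0%N v av).
apply: (@closed_prod _ _ (cts v) (@cts_cst v) (@cts_mul v)) => c.
exact: gup_continuous.
Qed.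

Lemma biquad_unit_curvature (A : 'M[R]_n) (X Y : 'rV[R]_n) : A^T = A ->
  biquad (unit_curvature A) X Y =
  mx_prod A X X * mx_prod A Y Y - mx_prod A X Y ^+ 2.
Proof.
move=> symA.
pose S (F : 'I_n -> 'I_n -> 'I_n -> 'I_n -> R) := \sum_i \sum_j \sum_k \sum_l F i j k l.
transitivity (S (fun i j k l => (A i k * X 0 i * X 0 k) * (A j l * Y 0 j * Y 0 l))
            - S (fun i j k l => (A i l * X 0 i * Y 0 l) * (A j k * Y 0 j * X 0 k))).
  rewrite /S -sumrB; apply: eq_bigr => i _; rewrite -sumrB; apply: eq_bigr => j _.
  rewrite -sumrB; apply: eq_bigr => k _; rewrite -sumrB; apply: eq_bigr => l _.
  by rewrite /unit_curvature; ring.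
have fac (a b : 'I_n -> 'I_n -> R) :
    \sum_i \sum_j \sum_k \sum_l a i k * b j l = (\sum_i \sum_k a i k) * \sum_j \sum_l b j l.
  rewrite mulr_suml; apply: eq_bigr => i _; rewrite exchange_big mulr_suml /=.
  by apply: eq_bigr => k _; rewrite mulr_sumr; apply: eq_bigr => j _; rewrite mulr_sumr.
congr (_ - _); first exact: fac.
rewrite expr2 [in X in _ = _ * X]/mx_prod.
have -> : \sum_i \sum_j A i j * X 0 i * Y 0 j = \sum_j \sum_k A j k * Y 0 j * X 0 k.
  rewrite exchange_big; apply: eq_bigr => j _; apply: eq_bigr => i _.
  by rewrite -[in LHS]symA mxE; ring.
rewrite -fac; apply: eq_bigr => i _; apply: eq_bigr => j _.
by rewrite exchange_big.
Qed.

(** On an orthonormal pair the unit curvature takes the value 1, so [riemann] plus [beta] times it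
    takes the value [sec + beta], which is at most 0. *)
Lemma weitz_inner_bound p (phi : components M p) (beta : R) a v :
  cdom a v ->
  (forall X Y : 'rV[R]_n, orthonormal2 g a v X Y -> sec g a v X Y <= - beta) ->
  traceless_sym_tensor g phi -> sym_tensor (weitzenboeck g phi a v) ->
  tensor_inner (gup g a v) (weitzenboeck g phi a v) (phi a v) <=
    - (p%:R * (n%:R + p%:R - 2) * beta) * chart_inner g phi phi a v.
Proof.
move=> av hsec [_ symphi trphi] symW.
have pG := metric_posdef g av.
have prodE X Y : mx_prod (G a v) X Y = gprod g a v X Y.
  by apply: eq_bigr => i _; apply: eq_bigr => j _; rewrite gdnE.
apply: (weitz_inner_le pG) symW => [i j k l|X Y|s i|b c i bc].
- exact: riemann_anti12.
- apply: (biquad_le0 pG) => [i j k l|i j k l|{}X {}Y XX YY XY].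
  + by rewrite riemann_anti12 /unit_curvature; ring.
  + by rewrite (@riemann_anti34 _ _ _ g a v i j k l av) /unit_curvature; ring.
  have -> : biquad (fun i j k l => riemann g a v i j k l + beta * unit_curvature (G a v) i j k l) X Y
      = sec g a v X Y + beta * biquad (unit_curvature (G a v)) X Y.
    rewrite /biquad mulr_sumr -big_split; apply: eq_bigr => i _ /=.
    rewrite mulr_sumr -big_split; apply: eq_bigr => j _ /=.
    rewrite mulr_sumr -big_split; apply: eq_bigr => k _ /=.
    rewrite mulr_sumr -big_split; apply: eq_bigr => l _ /=; ring.
  rewrite biquad_unit_curvature ?pG.1 // XX YY XY expr0n subr0 !mulr1 -lerBrDr sub0r.
  by apply: hsec; split; rewrite -prodE.
- exact: symphi.
- exact: trphi.
Qed.

End Pointwise.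

(** * Volume and integration *)

(* The integral of a nonnegative function is a supremum over simple functions,
   so no measurability is required. *)
Lemma integral_le_ge0 d (T : measurableType d) (R : realType)
    (mu : {measure set T -> \bar R}) (f h : T -> \bar R) :
  (forall x, (0 <= f x)%E) -> (forall x, (f x <= h x)%E) ->
  (\int[mu]_x f x <= \int[mu]_x h x)%E.
Proof.
move=> f0 fh; have h0 x : (0 <= h x)%E by apply: le_trans (fh x).
rewrite !ge0_integralTE //; apply: ereal_sup_le => _ [k kf <-].
by exists k => // x; apply: le_trans (fh x).
Qed.

Section IteratedIntegral.
Variable R : realType.
Local Notation mu := (@lebesgue_measure R).

Lemma iterated_integral_ge0 n (f : 'rV[R]_n -> \bar R) :
  (forall v, (0 <= f v)%E) -> (0 <= iterated_integral f)%E.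
Proof.
elim: n f => [|n IH] f f0 /=; first exact: f0.
by apply: integral_ge0 => t _; exact: IH.
Qed.

(** A closed cube written as a product over the coordinates, to follow the recursion of
    [iterated_integral]. *)
Definition box_indic n (c : 'rV[R]_n) (r : R) (v : 'rV[R]_n) : R :=
  \prod_i \1_(`[c 0 i - r, c 0 i + r]%classic : set R) (v 0 i).

Lemma box_indic_row n (c : 'rV[R]_(1 + n)) r (t : R) (w : 'rV[R]_n) :
  box_indic c r (row_mx (const_mx t) w) =
  \1_(`[c 0 ord0 - r, c 0 ord0 + r]%classic : set R) t * box_indic (rsubmx c) r w.
Proof.
have r0 : row_mx (const_mx t : 'rV_1) w 0 (@ord0 n) = t.
  have -> : @ord0 n = lshift n (@ord0 0) :> 'I_(1 + n) by apply: val_inj.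
  by rewrite row_mxEl mxE.
have rS i : row_mx (const_mx t : 'rV_1) w 0 (lift (@ord0 n) i) = w 0 i.
  have -> : lift (@ord0 n) i = rshift 1 i :> 'I_(1 + n) by apply: val_inj.
  by rewrite row_mxEr.
rewrite /box_indic big_ord_recl r0; congr (_ * _); apply: eq_bigr => i _.
rewrite rS mxE; have -> : lift (@ord0 n) i = rshift 1 i :> 'I_(1 + n) by apply: val_inj.
by [].
Qed.

Lemma box_indic_ge0 n (c : 'rV[R]_n) r v : 0 <= box_indic c r v.
Proof. by apply: prodr_ge0 => i _; rewrite indicE ler0n. Qed.

Lemma integral_box (C c r : R) : 0 <= C -> 0 <= r ->
  (\int[mu]_t (C * \1_(`[c - r, c + r]%classic : set R) t)%:E = (C * (2 * r))%:E)%E.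
Proof.
move=> C0 r0; under eq_integral => t _ do rewrite EFinM.
rewrite ge0_integralZl_EFin //; last first.
  exact/measurable_realfun.measurable_EFinP/measurable_realfun.measurable_indic.
rewrite integral_indic // setIT EFinM; congr (_ * _)%E.
rewrite [LHS](lebesgue_measure_itv `[c - r, c + r]) /= lte_fin; case: ltP => cr.
  by rewrite -EFinB; congr (_%:E); ring.
by congr (_%:E); lra.
Qed.

Lemma iterated_integral_le n (f : 'rV[R]_n -> \bar R) c r C : 0 <= C -> 0 <= r ->
  (forall v, (0 <= f v)%E) -> (forall v, (f v <= (C * box_indic c r v)%:E)%E) ->
  (iterated_integral f <= (C * (2 * r) ^+ n)%:E)%E.
Proof.
elim: n f c C => [|n IH] f c C C0 r0 f0 fC /=.
  by have := fC 0; rewrite /box_indic big_ord0 expr0.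
rewrite exprSr mulrA -(@integral_box _ (c 0 ord0)) ?mulr_ge0 ?exprn_ge0 ?mulr_ge0 //.
apply: integral_le_ge0 => t; first by apply: iterated_integral_ge0.
(* The indicator of the first coordinate is absorbed into the constant [C] of the induction
   hypothesis. *)
rewrite [X in (_ <= X%:E)%E]mulrAC; apply: IH => // [|w].
  by rewrite mulr_ge0 // indicE ler0n.
by have := fC (row_mx (const_mx (t : R) : 'rV[R]_1) w); rewrite (box_indic_row (n := n) c r t w) mulrA; exact.
Qed.

Lemma iterated_integral_ge n (f : 'rV[R]_n -> \bar R) c r C : 0 <= C -> 0 <= r ->
  (forall v, ((C * box_indic c r v)%:E <= f v)%E) ->
  ((C * (2 * r) ^+ n)%:E <= iterated_integral f)%E.
Proof.
elim: n f c C => [|n IH] f c C C0 r0 fC /=.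
  by have := fC 0; rewrite /box_indic big_ord0 expr0.
rewrite exprSr mulrA -(@integral_box _ (c 0 ord0)) ?mulr_ge0 ?exprn_ge0 ?mulr_ge0 //.
apply: integral_le_ge0 => t.
  by rewrite lee_fin !mulr_ge0 ?exprn_ge0 ?mulr_ge0 // indicE ler0n.
rewrite [X in (X%:E <= _)%E]mulrAC; apply: IH => // [|w].
  by rewrite mulr_ge0 // indicE ler0n.
by have := fC (row_mx (const_mx (t : R) : 'rV[R]_1) w); rewrite (box_indic_row (n := n) c r t w) mulrA; exact.
Qed.

End IteratedIntegral.

Section BoxIndicator.
Variables (R : realType) (n : nat).
Implicit Types (c v : 'rV[R]_n) (S : set 'rV[R]_n).

Lemma box_indicE c r v :
  box_indic c r v = [forall i, `|c 0 i - v 0 i| <= r]%R%:R.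
Proof.
have mem i : \1_(`[c 0 i - r, c 0 i + r]%classic : set R) (v 0 i) = (`|c 0 i - v 0 i| <= r)%R%:R :> R.
  rewrite indicE; congr (_%:R); congr nat_of_bool.
  rewrite mem_setE in_itv /= ler_norml; apply/andP/andP => -[]; lra.
case: forallP => [h|/forallP]; first by rewrite /box_indic big1 // => i _; rewrite mem h.
rewrite negb_forall => /existsP[i /negPf ni].
by rewrite /box_indic (bigD1 i) //= mem ni mul0r.
Qed.

(** Balls of row vectors are open cubes, so closed cubes bound them from inside and outside. *)
Lemma ball_rowP c r v : 0 < r -> ball c r v <-> forall i, `|c 0 i - v 0 i| < r.
Proof.
move=> r0; split=> [[_ h] i|h]; first exact: (h 0 i).
by split=> // i j; rewrite (ord1 i); exact: h.
Qed.

Lemma indic_ball_le c r v : \1_(ball c r) v <= box_indic c r v :> R.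
Proof.
rewrite indicE box_indicE ler_nat; have [|//] := boolP (v \in _).
rewrite inE => bv; have r0 : 0 < r by case: bv.
move: bv => /(ball_rowP _ _ r0) h; rewrite lt0b; apply/forallP => i; exact: ltW.
Qed.

Lemma indic_ball_ge c r s v : 0 < r -> s < r -> box_indic c s v <= \1_(ball c r) v :> R.
Proof.
move=> r0 sr; rewrite indicE box_indicE ler_nat; case: forallP => //= h.
rewrite mem_set //; apply/(ball_rowP _ _ r0) => i; exact: le_lt_trans sr.
Qed.
End BoxIndicator.

Section Volume.
Variables (R : realType) (n : nat) (M : manifold R n) (g : riemannian_metric M).
Variable vol : {measure set (borel M) -> \bar R}.
Hypothesis hvol : riemannian_volume g vol.
Implicit Types (a : chart_index M) (v : 'rV[R]_n).
Local Notation G := (comp2_mx (metric_comp g)).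
Local Notation coord a q := (chart_coord (atlas M a) q).

Definition patch a v (r : R) : set M :=
  [set q | chart_dom (atlas M a) q /\ ball v r (coord a q)].

Lemma patch_open a v r : open (patch a v r).
Proof.
rewrite openE => q [aq bq]; apply: filterI.
  by apply: open_nbhs_nbhs; split => //; exact: chart_dom_open.
apply: (chart_coord_continuous aq); apply: open_nbhs_nbhs; split => //.
exact: ball_open.
Qed.

Lemma patch_measurable a v r : measurable (patch a v r : set (borel M)).
Proof. by apply: sub_sigma_algebra; exact: patch_open. Qed.

Lemma patch_image a v r : ball v r `<=` cdom a ->
  chart_coord (atlas M a) @` patch a v r = ball v r.
Proof.
move=> sub; apply/seteqP; split=> [w [q [_ bq] <-] //|w bw].
by have [q aq qw] := sub _ bw; exists q => //; split; rewrite ?qw.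
Qed.

Lemma det_metric_gt0 a v : cdom a v -> 0 < \det (G a v).
Proof.
move=> av; have [e eE] := posdef_cholesky (metric_posdef g av).
rewrite lt_neqAle eq_sym det_metric_neq0 //= eE det_mulmx det_tr -expr2; exact: sqr_ge0.
Qed.

Lemma patch_volume_le a v (r C : R) : 0 <= C -> 0 <= r -> ball v r `<=` cdom a ->
  (forall w, ball v r w -> Num.sqrt (\det (G a w)) <= C) ->
  (vol (patch a v r) <= (C * (2 * r) ^+ n)%:E)%E.
Proof.
move=> C0 r0 sub hC; rewrite (hvol (a := a)); [|exact: patch_measurable|by move=> q []].
rewrite patch_image //; apply: (iterated_integral_le (c := v) C0 r0) => w.
  by rewrite lee_fin mulr_ge0 ?sqrtr_ge0 // indicE ler0n.
rewrite lee_fin mulrC; have := indic_ball_le v r w; rewrite indicE.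
have [|_ _] := boolP (w \in _); last by rewrite mulr0; apply: mulr_ge0; [exact: C0|exact: box_indic_ge0].
by rewrite inE => /hC h1 h2; rewrite mulr1; apply: le_trans h1 _; rewrite ler_peMr.
Qed.

Lemma patch_volume_gt0 a v (r C : R) : 0 < C -> 0 < r -> ball v r `<=` cdom a ->
  (forall w, ball v r w -> C <= Num.sqrt (\det (G a w))) ->
  (0 < vol (patch a v r))%E.
Proof.
move=> C0 r0 sub hC; rewrite (hvol (a := a)); [|exact: patch_measurable|by move=> q []].
rewrite patch_image //.
(* The closed cube of half-side r / 2 lies in the open ball of radius r. *)
apply: (@lt_le_trans _ _ (C * (2 * (r / 2)) ^+ n)%:E).
  by rewrite lte_fin mulr_gt0 // exprn_gt0 //; lra.
apply: (iterated_integral_ge (c := v)) => [||w]; [exact: ltW|by rewrite divr_ge0 // ltW|].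
rewrite lee_fin mulrC; have := @indic_ball_ge _ _ v r (r / 2) w r0; rewrite indicE.
have [|_] := boolP (w \in _).
  by rewrite inE => /hC h1 h2; apply: ler_pM => //; [exact: box_indic_ge0|exact: ltW|apply: h2; lra].
have := box_indic_ge0 v (r / 2) w; move=> b0 h2.
have -> : box_indic v (r / 2) w = 0 by apply/eqP; rewrite eq_le b0 h2 //; lra.
by rewrite !mul0r.
Qed.

End Volume.

Lemma compact_bounded_finite_volume (R : realType) (M : ptopologicalType)
    (vol : {measure set (borel M) -> \bar R}) (F : M -> R) :
  compact [set: M] ->
  (forall q, exists U : set M, [/\ open U, U q, (vol U < +oo)%E &
     exists C, forall x, U x -> F x <= C]) ->
  (vol [set: M] < +oo)%E /\ exists C, forall x, F x <= C.
Proof.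
rewrite compact_cover => cM locF; have {}locF q := cid (locF q).
pose U q := projT1 (locF q).
have openM (A : set M) : open A -> measurable (A : set (borel M)).
  by move=> oA; apply: sub_sigma_algebra.
have [|q _|D _ cov] := cM M setT U; first by move=> q _; have [] := projT2 (locF q).
  by exists q => //; have [] := projT2 (locF q).
(* The union of the finite subcover is built one set at a time: subadditivity keeps the volume
   finite and the larger of two bounds serves the union. *)
suff [B [oB subB volB [C hC]]] : exists B : set M, [/\ open B,
    (forall q, q \in enum_fset D -> U q `<=` B), (vol B < +oo)%E &
     exists C, forall x, B x -> F x <= C].
  have BT : B = setT.
    by apply/seteqP; split=> // x _; have [q qD Ux] := cov x I; exact: subB Ux.
  by rewrite -BT; split=> //; exists C => x; apply: hC; rewrite BT.
elim: (enum_fset D) => [|q s [B [oB subB volB [C hC]]]].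
  by exists set0; split; [exact: open0| |rewrite measure0|exists 0].
have [oU _ volU [C' hC']] := projT2 (locF q).
exists (U q `|` B); split.
- exact: openU.
- move=> x; rewrite inE => /orP[/eqP ->|/subB sub]; first exact: subsetUl.
  exact: subset_trans sub (@subsetUr _ _ _).
- apply: le_lt_trans (measureU2 _ (openM _ oU) (openM _ oB)) _.
  by rewrite lte_add_pinfty.
- exists (Num.max C C') => x [/hC'|/hC] h; rewrite le_max h ?orbT //.
Qed.

(** * Integration of the pointwise bound *)

Section EigenvalueBound.
Variables (R : realType) (n : nat) (M : manifold R n) (g : riemannian_metric M).
Variable vol : {measure set (borel M) -> \bar R}.
Hypothesis hvol : riemannian_volume g vol.
Local Notation G := (comp2_mx (metric_comp g)).
Local Notation coord a q := (chart_coord (atlas M a) q).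

(** The upper bound on the density serves for finite volume of a patch, the lower one for positive
    volume. *)
Lemma ball_volume_control a v (f : 'rV[R]_n -> R) (e : R) : cdom a v -> 0 < e ->
  f w @[w --> v] --> f v ->
  exists r : R, [/\ 0 < r, ball v r `<=` cdom a,
    forall w, ball v r w ->
      Num.sqrt (\det (G a v)) / 2 <= Num.sqrt (\det (G a w)) <= Num.sqrt (\det (G a v)) * 2
  & forall w, ball v r w -> `|f v - f w| < e].
Proof.
move=> av e0 cf.
have cdet : Num.sqrt (\det (G a w)) @[w --> v] --> Num.sqrt (\det (G a v)).
  exact: cvg_comp (det_metric_continuous av) (@sqrt_continuous R (\det (G a v))).
have s0 : 0 < Num.sqrt (\det (G a v)) by rewrite sqrtr_gt0 det_metric_gt0.
have A1 : \forall w \near v, cdom a w := near_cdom av.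
have A2 : \forall w \near v, `|f v - f w| < e by exact: (cvgrPdist_lt _ _).1 cf e e0.
have A3 : \forall w \near v,
    `|Num.sqrt (\det (G a v)) - Num.sqrt (\det (G a w))| < Num.sqrt (\det (G a v)) / 2.
  by apply: (cvgrPdist_lt _ _).1 cdet _ _; rewrite divr_gt0.
have /nbhs_ballP[r r0 hr] : \forall w \near v, [/\ cdom a w, `|f v - f w| < e &
   `|Num.sqrt (\det (G a v)) - Num.sqrt (\det (G a w))| < Num.sqrt (\det (G a v)) / 2].
  by apply: filterS3 A1 A2 A3 => w h1 h2 h3; split; [exact: h1|exact: h2|exact: h3].
exists r; split; first exact: r0.
- by move=> w /hr[].
- move=> w /hr[_ _]; move: (Num.sqrt _) (Num.sqrt _) s0 => s t s0.
  by rewrite ltr_norml => /andP[h1 h2]; apply/andP; split; lra.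
- by move=> w /hr[].
Qed.

Lemma inner_ge0 p (T : components M p) q : 0 <= inner g T T q.
Proof.
apply: (@tensor_inner_ge0 _ _ _ (G (chart_at q) (coord (chart_at q) q))).
apply: metric_posdef; exists q => //; rewrite /chart_at; case: cid => //.
Qed.

Lemma inner_eigen_le p (phi chi : components M p) (beta lambda : R) q :
  (forall a v X Y, cdom a v -> orthonormal2 g a v X Y -> sec g a v X Y <= - beta) ->
  traceless_sym_tensor g phi -> traceless_sym_tensor g chi ->
  (forall a v i, cdom a v -> lambda * phi a v i = chi a v i - weitzenboeck g phi a v i) ->
  inner g chi phi q <= (lambda - p%:R * (n%:R + p%:R - 2) * beta) * inner g phi phi q.
Proof.
move=> hsec tphi tchi eigen; rewrite !innerE; set a := chart_at q; set v := coord a q.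
have av : cdom a v by exists q => //; rewrite /a /chart_at; case: cid.
have chiE : chi a v = (fun i => weitzenboeck g phi a v i + lambda * phi a v i).
  by apply/funext => i; rewrite eigen // addrC subrK.
(* The eigenvalue equation expresses the Weitzenboeck term through the symmetric tensors [chi] and
   [phi]. *)
have symW : sym_tensor (weitzenboeck g phi a v).
  have WE i : weitzenboeck g phi a v i = chi a v i - lambda * phi a v i.
    by rewrite eigen // opprB addrC subrK.
  case: tphi tchi => [_ sphi _] [_ schi _] s i.
  by rewrite !WE schi // sphi.
rewrite /chart_inner chiE tensor_innerDl -/(chart_inner g phi phi a v).
have := weitz_inner_bound av (fun X Y => hsec a v X Y av) tphi symW.
rewrite -/(chart_inner g phi phi a v); move: (tensor_inner _ _ _) (chart_inner _ _ _ _ _) => w f.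
by move: (p%:R * _) => c; lra.
Qed.

Hypothesis hcompact : compact [set: M].

(* Testing the weak equation against phi itself: the integral of <chi, phi> is the
   integral of |nabla phi|^2, whereas <chi, phi> would be negative. *)
Lemma sampson_bound p (beta lambda : R) :
  (forall a v X Y, cdom a v -> orthonormal2 g a v X Y -> sec g a v X Y <= - beta) ->
  sampson_eigenvalue g vol p lambda -> p%:R * (n%:R + p%:R - 2) * beta <= lambda.
Proof.
move=> hsec [phi [tphi [a0 [v0 [i0 [av0 phi0]]]] [chi [tchi adj] eigen]]].
rewrite leNgt; apply/negP; set c := _ * beta => lc.
have sphi : smooth_tensor phi by case: tphi.
have schi : smooth_tensor chi by case: tchi.
(* With this sign [h] is nonnegative, so its integrals can be compared by [integral_le_ge0]. *)
pose h q := - inner g chi phi q.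
have h_ge q : (c - lambda) * inner g phi phi q <= h q.
  have := inner_eigen_le q hsec tphi tchi eigen; rewrite -/c /h.
  by move: (inner _ _ _ _) (inner _ _ _ _) => x y; lra.
have h_ge0 q : 0 <= h q.
  by apply: le_trans (h_ge q); apply: mulr_ge0; [rewrite subr_ge0 ltW|exact: inner_ge0].
(* The weak equation makes the integral of <chi, phi> equal to that of |nabla phi|^2. Since [fine]
   sends infinite values to 0, this yields a contradiction only once the integral of [h] is known to
   be finite. *)
have h_int : fine (\int[vol]_q (h q)%:E)%E <= 0.
  have := adj phi tphi; rewrite /L2prod /Rintegral.
  have -> : (\int[vol]_q (inner g chi phi q)%:E)%E = (- \int[vol]_q (h q)%:E)%E.
    rewrite -integral_ge0N => [|q _]; last by rewrite lee_fin.
    by apply: eq_integral => q _; rewrite -EFinN opprK.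
  rewrite fineN -oppr_ge0 => ->.
  by apply: fine_ge0; apply: integral_ge0 => q _; rewrite lee_fin inner_ge0.
have [volM [C hC]] : (vol [set: M] < +oo)%E /\ exists C, forall x, h x <= C.
  apply: compact_bounded_finite_volume => // q; pose a := chart_at q; pose v := coord a q.
  have aq : chart_dom (atlas M a) q by rewrite /a /chart_at; case: cid.
  have av : cdom a v by exists q.
  have [r [r0 sub hdet hf]] := ball_volume_control av ltr01 (chart_inner_continuous (g := g) schi sphi av).
  exists (patch a v r); split; first exact: patch_open.
  - by split=> //; exact: ballxx.
  - apply: le_lt_trans (ltry ((Num.sqrt (\det (G a v)) * 2) * (2 * r) ^+ n)).
    apply: (patch_volume_le hvol _ _ sub) => [||w /hdet/andP[]//]; last exact: ltW.
    by rewrite mulr_ge0 // sqrtr_ge0.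
  (* The radius [r] was chosen with tolerance 1 around the value at the centre. *)
  exists (1 - chart_inner g chi phi a v) => x [ax bx].
  rewrite /h (inner_chart g schi sphi ax).
  have := hf _ bx; move: (chart_inner _ _ _ _ _) (chart_inner _ _ _ _ _) => y z.
  by rewrite ltr_norml => /andP[h1 h2]; lra.
have int_fin : (\int[vol]_q (h q)%:E < +oo)%E.
  have C0 : 0 <= C by apply: le_trans (hC point); exact: h_ge0.
  apply: le_lt_trans (_ : _ <= \int[vol]_(q in setT) cst C%:E q)%E _.
    by apply: integral_le_ge0 => q; rewrite lee_fin.
  rewrite integral_cst //; apply: lte_mul_pinfty => //.
have int_pos : (0 < \int[vol]_q (h q)%:E)%E.
  have f0 : 0 < chart_inner g phi phi a0 v0 by apply: (tensor_inner_gt0 (metric_posdef g av0)) phi0.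
  have [r [r0 sub hdet hf]] :=
    ball_volume_control av0 (divr_gt0 f0 (ltr0Sn _ 1)) (chart_inner_continuous (g := g) sphi sphi av0).
  set s := chart_inner g phi phi a0 v0 in f0 hf.
  (* On the patch |phi|^2 exceeds half its value [s] at the centre, so [h] is at least [e] there. *)
  pose e := (c - lambda) * (s / 2).
  have e0 : 0 < e by rewrite mulr_gt0 ?subr_gt0 // divr_gt0.
  have s0 : 0 < Num.sqrt (\det (G a0 v0)) / 2 by rewrite divr_gt0 // sqrtr_gt0 det_metric_gt0.
  have volU := @patch_volume_gt0 _ _ _ _ _ hvol a0 v0 r _ s0 r0 sub (fun w bw => (andP (hdet w bw)).1).
  have mU := patch_measurable a0 v0 r.
  apply: lt_le_trans (_ : (0 < e%:E * vol (patch a0 v0 r))%E) _.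
    by rewrite mule_gt0.
  have <- : (\int[vol]_q (e%:E * (\1_(patch a0 v0 r) q)%:E))%E = (e%:E * vol (patch a0 v0 r))%E.
    rewrite ge0_integralZl_EFin //; last exact: ltW.
      by rewrite integral_indic // setIT.
    exact/measurable_realfun.measurable_EFinP/measurable_realfun.measurable_indic.
  apply: integral_le_ge0 => q.
    by rewrite mule_ge0 // lee_fin ?indicE ?ler0n // ltW.
  rewrite -EFinM lee_fin indicE; case: (boolP (q \in _)) => qU; last by rewrite mulr0.
  move: qU; rewrite inE => -[aq bq]; rewrite mulr1; apply: le_trans (h_ge q).
  rewrite ler_pM2l ?subr_gt0 // (inner_chart g sphi sphi aq).
  have := hf _ bq; move: (chart_inner _ _ _ _ _) => y.
  by rewrite ltr_norml => /andP[h1 h2]; lra.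
(* A finite value would be both positive and nonpositive; the two infinite ones are excluded by
   [int_fin] and [int_pos]. *)
move: h_int int_fin int_pos; case: (integral _ _ _) => [x| |] //=.
by rewrite lte_fin => x0 _; rewrite ltNge x0.
Qed.
End EigenvalueBound.

Theorem theorem3 (R : realType) (n : nat) (hn : (2 <= n)%N)
  (M : manifold R n)
  (hcompact : compact [set: M]) (hconnected : connected [set: M])
  (g : riemannian_metric M)
  (vol : {measure set (borel M) -> \bar R}) (hvol : riemannian_volume g vol)
  (beta : R) (hbeta : 0 < beta)
  (hsec : forall (a : chart_index M) (v X Y : 'rV[R]_n),
     cdom a v -> orthonormal2 g a v X Y ->
     - (n%:R / (n%:R - 1)) * beta < sec g a v X Y /\ sec g a v X Y <= - beta)
  (p : nat) (hp : (2 <= p)%N)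
  (lambda : R) (hlambda : sampson_eigenvalue g vol p lambda)
  (hlambda0 : lambda != 0) :
  p%:R * (n%:R + p%:R - 2) * beta <= lambda.
Proof.
apply: (sampson_bound hvol hcompact) hlambda => a v X Y av oXY.
exact: (hsec a v X Y av oXY).2.
Qed.
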